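(* Fix $0<p<1$ (independent of $n$), put $q=p^{-1}$ and $$z(n,p)=2\log_q n-2\log_q\log_q n+2\log_q(e/2)+1.$$ Fix an arbitrary $0<\epsilon<1/2$. Let $\Gamma$ be a random graph in the Erdős–Rényi model $\Omega_n$ with edge probability $p$ and let $K_\Gamma$ be the associated Eilenberg–MacLane complex. Then asymptotically almost surely $$2\lfloor z(n,p)-\epsilon\rfloor+1\;\le\;\mathsf{TC}(K_\Gamma)\;\le\;2\lfloor z(n,p)+\epsilon\rfloor+1,$$ i.e. the probability that $\Gamma\in\Omega_n$ does not satisfy these inequalities tends to $0$ as $n\to\infty$.
   Context: $\Omega_n$ is the probability space of all subgraphs of the complete graph on $\{1,\dots,n\}$, each edge included independently with probability $p$ (so a graph with $E_\Gamma$ edges has probability $p^{E_\Gamma}(1-p)^{\binom n2-E_\Gamma}$). For a graph $\Gamma$ with vertex set $V$, $|V|=n$, identify the torus $T^n$ with the set of functions $\phi:V\to S^1$; the support of $\phi$ is $\{v:\phi(v)\ne1\}$. $K_\Gamma\subset T^n$ is the subspace of all $\phi$ whose support spans a complete subgraph of $\Gamma$; it is an aspherical cell complex with fundamental group the right angled Artin group $G_\Gamma=\langle v\in V\mid vw=wv \text{ iff } (v,w) \text{ is an edge}\rangle$. For a space $X$, $\mathsf{TC}(X)$ (topological complexity) is the smallest integer $k$ such that $X\times X$ admits an open cover $U_1\cup\dots\cup U_k$ such that each $U_i$ admits a continuous section of the path fibration $PX\to X\times X$, $\gamma\mapsto(\gamma(0),\gamma(1))$, where $PX$ is the space of paths $[0,1]\to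 X$ with the compact-open topology. $\lfloor x\rfloor$ is the largest integer not exceeding $x$. *)

(* Defs.v *)
From HB Require Import structures.
From mathcomp Require Import all_boot all_order all_algebra.
From mathcomp Require Import all_classical all_reals all_analysis.
From mathcomp Require Import subtype_topology.
Set Implicit Arguments. Unset Strict Implicit. Unset Printing Implicit Defensive.
Import Order.TTheory GRing.Theory Num.Theory.
Import numFieldNormedType.Exports.
Local Open Scope classical_set_scope.
Local Open Scope ring_scope.

(* The unit interval [0,1] with the subspace topology (as a sigma type,
   topologised by the initial topology of the inclusion into R). *)
Notation unit_interval R := (set_type (`[0, 1]%classic : set (R : topologicalType))).

(* A continuous section of the free path fibration PX -> X x X over a set
   U of X x X.  PX is the set of continuous paths [0,1] -> X, a subspace of
   the function space with the compact-open topology; so a continuous section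
   over U is a map s : X * X -> {compact-open, [0,1] -> X} that is continuous
   on U (for the subspace topology of U), takes values in continuous paths
   on U, and satisfies (s u)(0) = u.1, (s u)(1) = u.2 for u in U. *)
Definition path_section (R : realType) (X : topologicalType) (U : set (X * X))
    (s : X * X -> {compact-open, unit_interval R -> X}) : Prop :=
  [/\ {within U, continuous s},
      (forall u, U u -> continuous (s u : unit_interval R -> X)),
      (forall u (t : unit_interval R), U u -> set_val t = 0 -> s u t = u.1) &
      (forall u (t : unit_interval R), U u -> set_val t = 1 -> s u t = u.2)].

Definition tc_cover (R : realType) (X : topologicalType) (k : nat) : Prop :=
  exists U : 'I_k -> set (X * X),
    (forall i, open (U i)) /\
    (\bigcup_i U i = [set: X * X]) /\
    (forall i, exists s, @path_section R X (U i) s).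

(* TC(X): the smallest k such that tc_cover X k holds
   (by convention 0 if there is no such k, which never happens for the
   finite complexes considered here). *)
Definition TC (R : realType) (X : topologicalType) : nat :=
  xget 0%N [set k | @tc_cover R X k /\ forall j, @tc_cover R X j -> (k <= j)%N].

(* A graph on {0,..,n-1} is given by its edge set, a set of pairs (i,j)
   with i < j. *)
Definition pairs_lt (n : nat) : {set 'I_n * 'I_n} :=
  [set ij : 'I_n * 'I_n | (ij.1 < ij.2)%N].

Definition adj (n : nat) (E : {set 'I_n * 'I_n}) (v w : 'I_n) : bool :=
  ((v, w) \in E) || ((w, v) \in E).

Definition S1 (R : realType) : set (R * R) := [set z | z.1 ^+ 2 + z.2 ^+ 2 = 1].
Definition S1_one (R : realType) : R * R := (1, 0).

(* K_Gamma as a subset of the torus T^n = (S^1)^n, seen inside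
   ('I_n -> R * R) with the product topology: the phi whose support
   {v | phi v <> 1} spans a complete subgraph of Gamma. *)
Definition K_set (R : realType) (n : nat) (E : {set 'I_n * 'I_n}) :
    set {ptws 'I_n -> (R * R)%type} :=
  [set phi : {ptws 'I_n -> (R * R)%type} | (forall v, S1 (phi v)) /\
     (forall v w, phi v <> S1_one R -> phi w <> S1_one R -> v <> w -> adj E v w)].

Notation K_Gamma R E := (set_type (@K_set R _ E)).

Definition prob_graph (R : realType) (p : R) (n : nat)
    (P : {set 'I_n * 'I_n} -> Prop) : R :=
  \sum_(E : {set 'I_n * 'I_n} | (E \subset pairs_lt n) && `[< P E >])
     p ^+ #|E| * (1 - p) ^+ ('C(n, 2) - #|E|).

Definition logb (R : realType) (q x : R) : R := ln x / ln q.

Definition zfun (R : realType) (n : nat) (p : R) : R :=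
  let q := p^-1 in
  2 * logb q n%:R - 2 * logb q (logb q n%:R) + 2 * logb q (expR 1 / 2) + 1.

(* Main.v *)
(** [K] denotes the complex of the graph, [c] its clique number.

    Upper bound: [K * K] is covered by [2c+1] open sets.  On the [k]-th one, the
    [k] coordinates of the two points that are farthest from [1] are strictly
    separated from the other ones; contracting every coordinate to [1] on the
    appropriate side of the circle moves the first point to the base point, and
    the reverse motion leads to the second point.  Supports never grow, so the
    motion stays in [K].

    Lower bound: let [A] and [B] be disjoint cliques.  Restricted to the torus
    [T^A * T^B], a motion planner over an open set [U] moves each coordinate
    circle to or from [1], so that the winding of the path is a primitive over
    [U] of the angular form of that coordinate.  On a fine grid of the torus,
    the angular 1-cochain of a coordinate is therefore cohomologous to one that
    vanishes on every cell inside [U].  With at most [|A| + |B|] open sets,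
    attributed to distinct coordinates, the product of these cochains vanishes
    on every cell, although its sum over the grid is that of the product of the
    angular cochains, which is not zero.

    Probability: the first moment method excludes cliques of size
    [floor (z + eps) + 1], and the second moment method provides two disjoint
    cliques of size [floor (z - eps)]. *)
Require Import Defs.
From HB Require Import structures.
From mathcomp Require Import all_boot all_order all_algebra.
From mathcomp Require Import all_classical all_reals all_analysis.
From mathcomp Require Import subtype_topology.
From mathcomp Require Import ring lra zify.
Import Order.TTheory GRing.Theory Num.Theory.
Import numFieldNormedType.Exports.
Set Implicit Arguments. Unset Strict Implicit. Unset Printing Implicit Defensive.
Local Open Scope ring_scope.

(** * Cochains on a finite grid *)

Section Forms.
Import boot.fintype boot.finset.
Variables (R : comNzRingType) (V : finZmodType) (n : nat) (e : 'I_n -> V).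
Implicit Types (A B : {set 'I_n}) (c : V -> 'I_n -> R) (h : V -> R).
Implicit Types w : V -> {set 'I_n} -> R.

(* A form assigns a coefficient to a base point [x] and a set [A] of
   directions; only the order of ['I_n] decides the sign. *)
Definition form_sign (a : 'I_n) A : R := (-1) ^+ #|[set b in A | (b < a)%N]|.

(** Cubical cup product of a 1-cochain with [w]: the factor [w] is read at the far end of the edge
    consumed by [c]. *)
Definition form_mul c w : V -> {set 'I_n} -> R :=
  fun x A => \sum_(a in A) form_sign a A * (c x a * w (x + e a) (A :\ a)).

(** Cubical coboundary: signed differences of opposite faces. *)
Definition form_d w : V -> {set 'I_n} -> R :=
  fun x A => \sum_(a in A) form_sign a A * (w (x + e a) (A :\ a) - w x (A :\ a)).

Definition form_one : V -> {set 'I_n} -> R := fun _ A => (A == set0)%:R.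

Definition dfun h : V -> 'I_n -> R := fun x a => h (x + e a) - h x.

(** Of [a] and [b], only the smaller is counted in the sign of the other, so exactly one of the two
    orders of removal loses a factor [-1]. *)
Lemma form_signD1 a b A : a != b -> a \in A -> b \in A ->
  form_sign a A * form_sign b (A :\ a) = - (form_sign b A * form_sign a (A :\ b)).
Proof.
move=> neq_ab aA bA.
have countD1 u v : u \in A -> #|[set i in A | (i < v)%N]| =
    ((u < v)%N + #|[set i in A :\ u | (i < v)%N]|)%N.
  move=> uA; rewrite (cardsD1 u) inE uA /=; congr (_ + _)%N.
  by apply: eq_card => i; rewrite !inE andbA.
rewrite /form_sign -!exprD (countD1 a b aA) (countD1 b a bA).
set p := #|_|; set q := #|_|.
have [lt_ab|lt_ba|/val_inj eq_ab] := ltngtP a b; last by rewrite eq_ab eqxx in neq_ab.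
- by rewrite add0n add1n [in RHS]addnC addnS exprS mulN1r opprK addnC.
- by rewrite add0n add1n addSn exprS mulN1r addnC.
Qed.

Lemma sum_antisym A (F : 'I_n -> 'I_n -> R) : (forall a b, F a b = F b a) ->
  \sum_(a in A) \sum_(b in A :\ a)
     form_sign a A * form_sign b (A :\ a) * F a b = 0.
Proof.
move=> Fsym.
pose G a b := form_sign a A * form_sign b (A :\ a) * F a b.
have Ganti a b : a \in A -> b \in A -> a != b -> G a b = - G b a.
  by move=> aA bA ab; rewrite /G form_signD1 // mulNr Fsym.
have split_lt a : a \in A -> \sum_(b in A :\ a) G a b =
    \sum_(b in A | (b < a)%N) G a b + \sum_(b in A | (a < b)%N) G a b.
  move=> aA; rewrite (bigID (fun b : 'I_n => (b < a)%N)) /=.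
  congr (_ + _); apply: eq_bigl => b; rewrite !inE.
    by have [->|] := eqVneq b a; rewrite ?ltnn ?andbF.
  rewrite -leqNgt leq_eqVlt -(inj_eq val_inj) eq_sym.
  by have [->|] := eqVneq (val b) (val a); rewrite ?ltnn ?andbF.
rewrite (eq_bigr _ split_lt) big_split /= [X in _ + X](exchange_big_dep (mem A)) /=;
  last by move=> a b _ /andP[].
rewrite -big_split big1 // => a aA /=.
rewrite [X in _ + X](eq_bigl (fun b : 'I_n => (b \in A) && (b < a)%N)); last first.
  by move=> b; rewrite aA.
rewrite -big_split big1 // => b /andP[bA ba] /=.
by rewrite (Ganti a b) ?addNr // -(inj_eq val_inj) neq_ltn ba orbT.
Qed.

(** Leibniz rule. The two sides differ by a double sum over pairs of directions, with antisymmetric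
    signs and a coefficient [F] that is symmetric because [c] is closed on every square. *)
Lemma form_d_mul c w : (forall x a b, c x a + c (x + e a) b = c x b + c (x + e b) a) ->
  forall x A, form_d (form_mul c w) x A = - form_mul c (form_d w) x A.
Proof.
move=> c_closed x A; apply/eqP; rewrite -addr_eq0; apply/eqP.
pose F a b := (c x a + c (x + e a) b) * w (x + e a + e b) (A :\ a :\ b)
   - (c x a * w (x + e a) (A :\ a :\ b) + c x b * w (x + e b) (A :\ a :\ b)).
rewrite -[RHS](@sum_antisym A F); last first.
  move=> a b; rewrite /F c_closed addrAC setDDl setUC -setDDl.
  by rewrite [c x a * _ + _]addrC.
rewrite -big_split; apply: eq_bigr => a aA /=.
rewrite -mulrDr; under [RHS]eq_bigr do rewrite -mulrA.
rewrite -mulr_sumr; congr (_ * _).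
rewrite /form_mul /form_d mulr_sumr -sumrB -big_split; apply: eq_bigr => b bA /=.
rewrite /F addrAC; ring.
Qed.

Lemma form_mul_dfun h w x A :
  form_mul (dfun h) w x A = form_d (fun y B => h y * w y B) x A - h x * form_d w x A.
Proof.
rewrite /form_mul /form_d mulr_sumr -sumrB; apply: eq_bigr => a _ /=.
rewrite /dfun; ring.
Qed.

(** Stokes formula on a closed grid: translation by [e a] permutes the base points, so opposite
    faces cancel. *)
Lemma sum_form_d w A : \sum_x form_d w x A = 0.
Proof.
rewrite exchange_big big1 // => a _; rewrite -mulr_sumr sumrB.
rewrite [X in X - _](reindex_onto (fun x => x - e a) (fun x => x + e a)) /=; last first.
  by move=> x _; rewrite addrK.
rewrite [X in X - _](eq_bigl xpredT); last by move=> x; rewrite subrK eqxx.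
by rewrite (eq_bigr (fun x => w x (A :\ a))) ?subrr ?mulr0 // => x _; rewrite subrK.
Qed.

Lemma form_d_one x A : form_d form_one x A = 0.
Proof. by rewrite /form_d big1 // => a _; rewrite /form_one subrr mulr0. Qed.

Definition unit_cochain (t : R) (i : 'I_n) : V -> 'I_n -> R := fun _ a => (a == i)%:R * t.

Definition form_prod (cs : seq (V -> 'I_n -> R)) := foldr form_mul form_one cs.

(* The two products differ by an exact form, as [d] anticommutes with
   multiplication by closed cochains. *)
Lemma form_prod_exact t (h : 'I_n -> V -> R) (s : seq 'I_n) :
  let w0 := form_prod [seq unit_cochain t i | i <- s] in
  let w := form_prod [seq (fun x a => unit_cochain t i x a + dfun (h i) x a) | i <- s] in
  (forall x A, form_d w0 x A = 0) /\
  exists eta, forall x A, w x A = w0 x A + form_d eta x A.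
Proof.
elim: s => [|i s [IHd [eta IHe]]] /=.
  split=> [|]; first exact: form_d_one.
  exists (fun _ _ => 0) => x A; rewrite [form_d _ _ _]big1 ?addr0 // => a _.
  by rewrite subrr mulr0.
set w0 := form_prod _ in IHd IHe *; set w := form_prod _ in IHe *.
have closed_unit x a b : unit_cochain t i x a + unit_cochain t i (x + e a) b =
    unit_cochain t i x b + unit_cochain t i (x + e b) a.
  by rewrite /unit_cochain addrC.
set c := fun x a => _ + _.
have c_closed x a b : c x a + c (x + e a) b = c x b + c (x + e b) a.
  rewrite /c /dfun /unit_cochain -!addrA [e a + e b]addrC; ring.
split=> [x A|].
  rewrite form_d_mul // /form_mul big1 ?oppr0 // => a _.
  by rewrite IHd !mulr0.
(* As [w0] is closed, [h i * w0] produces the contribution of [dfun (h i)]; by [form_d_mul], the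
   second term produces [c] times the earlier exact form. *)
exists (fun y B => h i y * w0 y B - form_mul c eta y B) => x A.
have dB : form_d (fun y B => h i y * w0 y B - form_mul c eta y B) x A =
    form_d (fun y B => h i y * w0 y B) x A - form_d (form_mul c eta) x A.
  rewrite /form_d -sumrB; apply: eq_bigr => a _; ring.
rewrite dB form_d_mul // opprK.
have -> : form_d (fun y B => h i y * w0 y B) x A = form_mul (dfun (h i)) w0 x A.
  by rewrite form_mul_dfun IHd mulr0 subr0.
rewrite /form_mul -!big_split /=; apply: eq_bigr => a _ /=.
rewrite IHe /c; ring.
Qed.

(** Ranges over the faces of the cube based at [x]: a face in the directions [A] starts at a vertex
    reached along a disjoint set [B]. *)
Definition zero_on_cell x w := forall A B, [disjoint A & B] ->
  w (x + \sum_(b in B) e b) A = 0.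

(** A product reads its factors only on faces of the same cube, since the edge [a] consumed by the
    head passes from [A] to [B]. One factor that vanishes on all edges of the cube therefore kills
    the product. *)
Lemma form_prod_zero x (cs : seq (V -> 'I_n -> R)) j :
  (j < size cs)%N ->
  (forall B a, a \notin B -> nth (fun _ _ => 0) cs j (x + \sum_(b in B) e b) a = 0) ->
  zero_on_cell x (form_prod cs).
Proof.
elim: cs j => [|c cs IH] [|j] //= lt_j cj0 A B disAB; rewrite /form_mul big1 // => a aA.
  by rewrite cj0 ?(disjointFr disAB) // mul0r mulr0.
have aB : a \notin B by rewrite (disjointFr disAB).
rewrite -addrA [_ + e a]addrC -(big_setU1 _ aB) (IH j) ?mulr0 //.
rewrite disjoint_sym -setI_eq0; apply/eqP/setP => b; rewrite !inE.
by case: eqP => //= _; case bA: (b \in A); rewrite ?andbF // (disjointFr disAB bA).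
Qed.

(** Each factor [i] contributes only in the direction [i]; the resulting sign does not depend on
    [x]. *)
Lemma form_prod_unit t (s : seq 'I_n) : uniq s -> exists k : nat, forall x,
  form_prod [seq unit_cochain t i | i <- s] x [set i in s] = (-1) ^+ k * t ^+ size s.
Proof.
elim: s => [_|i s IH /= /andP[i_s /IH[k Hk]]].
  exists 0%N => x; rewrite /= /form_one; case: eqP => [_|[]]; first by rewrite !expr0 mulr1.
  by apply/setP => i; rewrite !inE.
exists (#|[set b in [set j in i :: s] | (b < i)%N]| + k)%N => x.
rewrite [LHS]/form_mul (bigD1 i) /=; last by rewrite !inE eqxx.
rewrite big1 ?addr0 => [|a /andP[_ /negPf ai]]; last first.
  by rewrite /unit_cochain ai !mul0r mulr0.
have -> : [set j in i :: s] :\ i = [set j in s].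
  by apply/setP => j; rewrite !inE; case: eqP => //= ->; rewrite (negPf i_s).
by rewrite Hk /unit_cochain eqxx mul1r exprS exprD /form_sign; ring.
Qed.

End Forms.

Section CochainObstruction.
Import boot.fintype boot.finset.
(** If on each cell some corrected cochain vanished, their product would be zero everywhere. It
    differs by an exact form, of total sum zero, from the product of the constant cochains, whose
    total is [#|V|] times a nonzero number. *)
Lemma cochain_obstruction (R : numDomainType) (V : finZmodType) (n : nat) (e : 'I_n -> V)
    (t : R) (h : 'I_n -> V -> R) (s : seq 'I_n) : uniq s -> t != 0 ->
  ~ (forall x, exists2 i, i \in s & forall (B : {set 'I_n}) a, a \notin B ->
       let y := x + \sum_(b in B) e b in (a == i)%:R * t + (h i (y + e a) - h i y) = 0).
Proof.
move=> s_uniq t_neq0 H.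
have [_ [eta Heta]] := form_prod_exact e t h s.
have [k Hk] := form_prod_unit e t s_uniq.
set w := form_prod e _ in Heta.
have w0 x : w x [set i in s] = 0.
  have [i i_s Hi] := H x.
  have cell0 : zero_on_cell e x w.
    apply: (@form_prod_zero _ _ _ _ x _ (index i s)); first by rewrite size_map index_mem.
    by move=> B a aB; rewrite (nth_map i) ?index_mem // nth_index //; exact: Hi.
  have := cell0 [set i in s] set0; rewrite big_set0 addr0; apply.
  by rewrite -setI_eq0 setI0.
have : \sum_(x : V) w x [set i in s] = 0 by rewrite big1.
under eq_bigr do rewrite Heta Hk.
rewrite big_split /= sum_form_d addr0 sumr_const; apply/eqP.
rewrite mulrn_eq0 negb_or mulf_neq0 ?signr_eq0 ?expf_neq0 // andbT -lt0n.
by apply/card_gt0P; exists 0.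
Qed.

End CochainObstruction.

(** * Moments of the number of cliques *)

Section RandomGraphs.
Import boot.fintype boot.finset.

Lemma setU_setDK (T : finType) (A B : {set T}) : A \subset B -> A :|: B :\: A = B.
Proof. by move=> /setIidPr AB; rewrite -[in RHS](setID B A) AB. Qed.

Lemma sum_subsets_binomial (R : comNzRingType) (T : finType) (p : R) (D : {set T}) :
  \sum_(E : {set T} | E \subset D) p ^+ #|E| * (1 - p) ^+ (#|D| - #|E|) = 1.
Proof.
transitivity ((1 - p + p) ^+ #|D|); last by rewrite subrK expr1n.
rewrite exprDn.
rewrite (partition_big (fun E : {set T} => inord #|E| : 'I_(#|D|.+1)) xpredT) //=.
apply: eq_bigr => i _.
rewrite (eq_bigl (fun E : {set T} => E \in [set E : {set T} | E \subset D & #|E| == i])); last first.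
  move=> E; rewrite !inE; case ED: (E \subset D) => //=.
  by rewrite -val_eqE /= inordK // ltnS subset_leq_card.
rewrite (eq_bigr (fun=> (1 - p) ^+ (#|D| - i) * p ^+ i)); last first.
  by move=> E; rewrite inE => /andP[_ /eqP ->]; rewrite mulrC.
by rewrite sumr_const cards_draws.
Qed.

(** Probability that a random subset of [D] contains [F]: the elements of [D :\: F] remain free. *)
Lemma sum_supersets_binomial (R : comNzRingType) (T : finType) (p : R) (D F : {set T}) :
  F \subset D ->
  \sum_(E : {set T} | (E \subset D) && (F \subset E))
     p ^+ #|E| * (1 - p) ^+ (#|D| - #|E|) = p ^+ #|F|.
Proof.
move=> FD.
rewrite (reindex_onto (fun G => F :|: G) (fun E => E :\: F)) /=; last first.
  by move=> E /andP[_ FE]; rewrite setU_setDK.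
rewrite (eq_bigl (fun G : {set T} => G \subset D :\: F)); last first.
  move=> G; rewrite subUset FD subsetUl andbT /= subsetD; congr (_ && _).
  rewrite setDUl setDv set0U; apply/eqP/idP => [<-|].
    by rewrite disjoint_sym -setI_eq0 setIDA setDIl setDv set0I.
  by rewrite disjoints_subset => GF; apply/setP => i; rewrite inE andbC;
    case Gi: (i \in G) => //=; have := subsetP GF i Gi; rewrite inE.
rewrite (eq_bigr (fun G : {set T} => p ^+ #|F| *
   (p ^+ #|G| * (1 - p) ^+ (#|D :\: F| - #|G|)))); last first.
  move=> G; rewrite subsetD disjoint_sym => /andP[_ dFG].
  rewrite cardsU disjoint_setI0 // cards0 subn0.
  by rewrite exprD mulrA cardsD (setIidPr FD) subnDA.
by rewrite -mulr_sumr sum_subsets_binomial mulr1.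
Qed.

Definition pairs_in (n : nat) (S : {set 'I_n}) : {set 'I_n * 'I_n} :=
  [set ij in pairs_lt n | (ij.1 \in S) && (ij.2 \in S)].

Lemma card_pairs_in (n : nat) (S : {set 'I_n}) : #|pairs_in S| = 'C(#|S|, 2).
Proof.
rewrite -cards_draws -(@card_in_imset _ _ (fun ij => [set ij.1; ij.2]) (pairs_in S)).
  apply: eq_card => D; rewrite !inE; apply/imsetP/andP => [[[i j]]|[DS]].
    rewrite !inE /= => /and3P[ij iS jS] ->; split; last by rewrite cards2 -val_eqE neq_ltn ij.
    by apply/subsetP => k; rewrite !inE => /orP[]/eqP ->.
  case/cards2P => x [y [xy Dxy]]; subst D.
  have xS : x \in S by apply: (subsetP DS); rewrite !inE eqxx.
  have yS : y \in S by apply: (subsetP DS); rewrite !inE eqxx orbT.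
  move: xy; rewrite -val_eqE neq_ltn => /orP[xy|yx].
    by exists (x, y); rewrite ?inE ?xS ?yS ?xy.
  by exists (y, x); rewrite ?inE ?xS ?yS ?yx //= setUC.
move=> [i j] [k l]; rewrite !inE /= => /and3P[ij _ _] /and3P[kl _ _] /setP eqD.
have := eqD i; have := eqD j; have := eqD k; rewrite !inE !eqxx /= ?orbT.
move=> H1 H2 H3; apply/eqP; rewrite xpair_eqE -!val_eqE /=.
move: H1 H2 H3; rewrite -!val_eqE /=; lia.
Qed.

Lemma pairs_inT n : pairs_in [set: 'I_n] = pairs_lt n.
Proof. by apply/setP => ij; rewrite !inE !andbT. Qed.

Lemma card_pairs_lt n : #|pairs_lt n| = 'C(n, 2).
Proof. by rewrite -pairs_inT card_pairs_in cardsT card_ord. Qed.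

Definition clique (n : nat) (E : {set 'I_n * 'I_n}) (S : {set 'I_n}) : bool :=
  [forall v in S, forall w in S, (v != w) ==> adj E v w].

Lemma cliqueP (n : nat) (E : {set 'I_n * 'I_n}) (S : {set 'I_n}) :
  reflect (forall v w, v \in S -> w \in S -> v != w -> adj E v w) (clique E S).
Proof.
apply: (iffP forall_inP) => [H v w vS wS vw|H v vS].
  by have /forall_inP/(_ _ wS)/implyP := H v vS; apply.
by apply/forall_inP => w wS; apply/implyP; exact: H.
Qed.

Lemma clique_pairs_in (n : nat) (E : {set 'I_n * 'I_n}) (S : {set 'I_n}) :
  E \subset pairs_lt n -> clique E S = (pairs_in S \subset E).
Proof.
move=> /subsetP Elt; apply/cliqueP/subsetP => [H [i j]|H v w vS wS].
  rewrite !inE /= => /and3P[ij iS jS].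
  have /orP[//|/Elt] : adj E i j by apply: H; rewrite // -val_eqE neq_ltn ij.
  by rewrite inE /= ltnNge ltnW.
rewrite -val_eqE neq_ltn /adj => /orP[lt|lt].
  by rewrite H // !inE /= lt vS.
by rewrite orbC H // !inE /= lt vS wS.
Qed.

Lemma clique_subset (n : nat) (E : {set 'I_n * 'I_n}) (S T : {set 'I_n}) :
  T \subset S -> clique E S -> clique E T.
Proof.
move=> /subsetP TS /cliqueP H; apply/cliqueP => v w vT wT; apply: H; exact: TS.
Qed.

Lemma card_draws_pred (T : finType) (k : nat) :
  #|[pred S : {set T} | #|S| == k]| = 'C(#|T|, k).
Proof. by rewrite -card_draws cardsE; apply: eq_card => S; rewrite !inE. Qed.

Lemma mul_bin_sub (n k l : nat) : (l <= k <= n)%N ->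
  ('C(n, k) * 'C(k, l))%N = ('C(n, l) * 'C(n - l, k - l))%N.
Proof.
move=> /andP[lk kn]; have ln := leq_trans lk kn.
have e1 := bin_fact kn; have e2 := bin_fact lk; have e3 := bin_fact ln.
have := @bin_fact (n - l) (k - l); rewrite leq_sub2r // => /(_ isT).
have -> : (n - l - (k - l) = n - k)%N by lia.
move=> e4; apply/eqP.
rewrite -(eqn_pmul2r (fact_gt0 l)) -(eqn_pmul2r (fact_gt0 (k - l))).
rewrite -(eqn_pmul2r (fact_gt0 (n - k))); apply/eqP.
transitivity (n`!).
  by rewrite -e1 -e2; ring.
by rewrite -e3 -e4; ring.
Qed.

(** * Expectations over the random graph *)

Section RandomGraph.
Variables (R : realType) (p : R) (n : nat).
Hypotheses (p_gt0 : 0 < p) (p_lt1 : p < 1).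
Implicit Types (E F : {set 'I_n * 'I_n}) (S T : {set 'I_n}).

Definition graph_weight E : R := p ^+ #|E| * (1 - p) ^+ ('C(n, 2) - #|E|).

Definition expectation (f : {set 'I_n * 'I_n} -> R) : R :=
  \sum_(E : {set 'I_n * 'I_n} | E \subset pairs_lt n) graph_weight E * f E.

Lemma graph_weight_ge0 E : 0 <= graph_weight E.
Proof. by rewrite mulr_ge0 // exprn_ge0 // ?subr_ge0 ltW. Qed.

Lemma prob_graphE (P : {set 'I_n * 'I_n} -> Prop) :
  prob_graph p P = expectation (fun E => (`[< P E >])%:R).
Proof.
rewrite /prob_graph /expectation big_mkcondr; apply: eq_bigr => E _.
by case: asboolP => _; rewrite ?mulr1 ?mulr0.
Qed.

Lemma le_expectation f g : (forall E, E \subset pairs_lt n -> f E <= g E) ->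
  expectation f <= expectation g.
Proof.
by move=> fg; apply: ler_sum => E /fg; apply: ler_wpM2l; exact: graph_weight_ge0.
Qed.

Lemma expectationD f g :
  expectation (fun E => f E + g E) = expectation f + expectation g.
Proof. by rewrite /expectation -big_split; apply: eq_bigr => E _; rewrite mulrDr. Qed.

Lemma expectationZ a f : expectation (fun E => a * f E) = a * expectation f.
Proof. by rewrite /expectation mulr_sumr; apply: eq_bigr => E _; rewrite mulrCA. Qed.

Lemma expectation_sum (I : finType) (Q : pred I) (f : I -> {set 'I_n * 'I_n} -> R) :
  expectation (fun E => \sum_(i | Q i) f i E) = \sum_(i | Q i) expectation (f i).
Proof.
rewrite /expectation exchange_big; apply: eq_bigr => E _; exact: mulr_sumr.
Qed.

Lemma expectation_supersets F : F \subset pairs_lt n ->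
  expectation (fun E => (F \subset E)%:R) = p ^+ #|F|.
Proof.
move=> FD; rewrite -(sum_supersets_binomial p FD) big_mkcondr.
apply: eq_bigr => E _; rewrite /graph_weight card_pairs_lt.
by case: ifP; rewrite ?mulr1 ?mulr0.
Qed.

Lemma expectation_cst a : expectation (fun=> a) = a.
Proof.
have := @expectation_supersets set0; rewrite cards0 expr0 sub0set => /(_ isT) e1.
rewrite -[RHS]mulr1 -e1 -expectationZ; apply: eq_bigr => E _.
by rewrite sub0set mulr1.
Qed.

Lemma prob_graph_ge0 (P : {set 'I_n * 'I_n} -> Prop) : 0 <= prob_graph p P.
Proof. by apply: sumr_ge0 => E _; exact: graph_weight_ge0. Qed.

Lemma prob_graph_union (P Q1 Q2 : {set 'I_n * 'I_n} -> Prop) :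
  (forall E, E \subset pairs_lt n -> P E -> Q1 E \/ Q2 E) ->
  prob_graph p P <= prob_graph p Q1 + prob_graph p Q2.
Proof.
move=> H; rewrite !prob_graphE -expectationD; apply: le_expectation => E ED.
case: asboolP => [/(H _ ED)[q|q]|_].
- by rewrite (asboolT q) lerDl.
- by rewrite (asboolT q) lerDr.
- by rewrite addr_ge0.
Qed.

Lemma pairs_in_lt S : pairs_in S \subset pairs_lt n.
Proof. by apply/subsetP => ij; rewrite inE => /andP[]. Qed.

Lemma expectation_clique S : expectation (fun E => (clique E S)%:R) = p ^+ 'C(#|S|, 2).
Proof.
rewrite -card_pairs_in -expectation_supersets ?pairs_in_lt //.
by apply: eq_bigr => E ED; rewrite clique_pairs_in.
Qed.

(** All edges of both cliques are required; those inside [S :&: T] are shared. *)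
Lemma expectation_clique2 S T :
  expectation (fun E => (clique E S && clique E T)%:R) =
  p ^+ ('C(#|S|, 2) + 'C(#|T|, 2) - 'C(#|S :&: T|, 2)).
Proof.
have <- : #|pairs_in S :|: pairs_in T| =
    ('C(#|S|, 2) + 'C(#|T|, 2) - 'C(#|S :&: T|, 2))%N.
  rewrite cardsU !card_pairs_in; congr (_ - _)%N; rewrite -card_pairs_in.
  apply: eq_card => ij; rewrite !inE.
  by case: (ij.1 < ij.2)%N; case: (_ \in S); case: (_ \in S); case: (_ \in T); case: (_ \in T).
rewrite -expectation_supersets ?subUset ?pairs_in_lt //.
by apply: eq_bigr => E ED; rewrite !clique_pairs_in // subUset.
Qed.

Lemma prob_clique_le k :
  prob_graph p (fun E => exists2 S : {set 'I_n}, #|S| = k & clique E S) <= ('C(n, k))%:R * p ^+ 'C(k, 2).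
Proof.
rewrite prob_graphE.
apply: (@le_trans _ _ (expectation (fun E => \sum_(S : {set 'I_n} | #|S| == k) (clique E S)%:R))).
  apply: le_expectation => E _; case: asboolP => [[S Sk cS]|_]; last exact: sumr_ge0.
  by rewrite (bigD1 S) ?Sk ?eqxx //= cS lerDl sumr_ge0.
rewrite expectation_sum (eq_bigr (fun=> p ^+ 'C(k, 2))); last first.
  by move=> S /eqP Sk; rewrite expectation_clique Sk.
by rewrite sumr_const card_draws_pred card_ord mulr_natl.
Qed.

Lemma card_supersets (k l : nat) (S : {set 'I_n}) : #|S| = l ->
  #|[set T : {set 'I_n} | (S \subset T) && (#|T| == k)]| = (if (l <= k)%N then 'C(n - l, k - l) else 0)%N.
Proof.
move=> Sl; case: leqP => lk; last first.
  apply/eqP; rewrite cards_eq0; apply/eqP/setP => T; rewrite !inE.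
  by apply/negP => /andP[/subset_leq_card + /eqP Tk]; rewrite Tk Sl leqNgt lk.
have -> : (n - l)%N = #|~: S| by rewrite cardsCs setCK Sl card_ord.
rewrite -cards_draws -(@card_in_imset _ _ (fun T => T :\: S) [set T | _]); last first.
  move=> T1 T2; rewrite !inE => /andP[s1 _] /andP[s2 _] eqD.
  by rewrite -(setU_setDK s1) eqD setU_setDK.
apply: eq_card => D; apply/imsetP/idP => [[T]|].
  rewrite !inE => /andP[ST /eqP Tk] ->; rewrite setDE subsetIr /= -setDE.
  by rewrite cardsD (setIidPr ST) Tk Sl.
rewrite !inE => /andP[DS /eqP Dk]; have dis : S :&: D = set0.
  by apply/eqP; rewrite setI_eq0 disjoint_sym disjoints_subset.
exists (S :|: D); last first.
  by rewrite setDUl setDv set0U setDE (setIidPl DS).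
by rewrite inE subsetUl cardsU dis cards0 subn0 Sl Dk subnKC ?eqxx.
Qed.

Definition disjoint_cliques (E : {set 'I_n * 'I_n}) (r : nat) : Prop :=
  exists S T : {set 'I_n}, [/\ #|S| = r, #|T| = r, [disjoint S & T], clique E S & clique E T].

(** Contribution of the overlap sizes [l] to the second moment, divided by the squared mean: there
    are ['C(r, l)] possible shared subsets of a clique, a random [r]-set contains a given one with
    probability ['C(r, l) / 'C(n, l)], and [p ^- 'C(l, 2)] accounts for the shared edges. *)
Definition overlap_sum (r : nat) : R :=
  \sum_(1 <= l < r.+1) ('C(r, l))%:R ^+ 2 / ('C(n, l))%:R * p ^- 'C(l, 2).

Lemma sum_overlapping_le r (S : {set 'I_n}) : (r <= n)%N -> #|S| = r ->
  \sum_(T : {set 'I_n} | (#|T| == r) && ~~ [disjoint S & T])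
     p ^+ ('C(r, 2) + 'C(r, 2) - 'C(#|S :&: T|, 2))
  <= ('C(n, r))%:R * p ^+ 'C(r, 2) ^+ 2 * overlap_sum r.
Proof.
move=> rn Sr.
pose g l : R := p ^+ 'C(r, 2) ^+ 2 * p ^- 'C(l, 2).
have g_ge0 l : 0 <= g l.
  by apply: mulr_ge0; rewrite ?invr_ge0 !exprn_ge0 // ltW.
(* Overcount: [T] is charged for all nonempty subsets [S'] of [S :&: T], although [S' = S :&: T]
   alone gives the wanted term. After exchanging sums, the sets [T] containing a given [S'] are easy
   to count. *)
apply: (@le_trans _ _ (\sum_(T : {set 'I_n} | (#|T| == r))
   \sum_(1 <= l < r.+1) \sum_(S' : {set 'I_n} | (S' \subset S) && (#|S'| == l))
     (S' \subset T)%:R * g l)).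
  rewrite [leRHS](bigID (fun T => ~~ [disjoint S & T])) /= -[leLHS]addr0.
  apply: lerD; last first.
    by apply: sumr_ge0 => T _; apply: sumr_ge0 => l _; apply: sumr_ge0 => S' _;
      rewrite mulr_ge0.
  apply: ler_sum => T /andP[/eqP Tr ST].
  set l := #|S :&: T|.
  have l_gt0 : (0 < l)%N by rewrite card_gt0 setI_eq0.
  have l_le : (l <= r)%N by rewrite -Sr subset_leq_card // subsetIl.
  rewrite (bigD1_seq l) ?iota_uniq ?mem_index_iota ?l_gt0 //=.
  rewrite (bigD1 (S :&: T)) /=; last by rewrite subsetIl eqxx.
  rewrite subsetIr mul1r -addrA ler_wpDr //.
    apply: addr_ge0; first by apply: sumr_ge0 => S' _; rewrite mulr_ge0.
    by apply: sumr_ge0 => i _; apply: sumr_ge0 => S' _; rewrite mulr_ge0.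
  have l2r : ('C(l, 2) <= 'C(r, 2))%N by exact: leq_bin2l.
  by rewrite /g -exprM muln2 -addnn expfB_cond // (gt_eqF p_gt0); lia.
rewrite exchange_big /= /overlap_sum mulr_sumr !big_nat; apply: ler_sum => l /andP[l_gt0 lr].
rewrite exchange_big /=.
rewrite (eq_bigr (fun=> ('C(n - l, r - l))%:R * g l)); last first.
  move=> S' /andP[_ /eqP S'l]; rewrite -mulr_suml; congr (_ * _).
  have := @card_supersets r l S' S'l; rewrite -ltnS lr => <-.
  by rewrite -sum1dep_card natr_sum big_mkcondl; apply: eq_bigr => T _; case: ifP.
rewrite sumr_const.
have -> : #|[pred S' : {set 'I_n} | (S' \subset S) && (#|S'| == l)]| = 'C(r, l).
  by rewrite -Sr -cards_draws; apply: eq_card => S'; rewrite !inE.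
have Cnl : ('C(n, l))%:R != 0 :> R.
  by rewrite pnatr_eq0 -lt0n bin_gt0; apply: leq_trans rn; rewrite -ltnS.
rewrite le_eqVlt; apply/orP; left; apply/eqP; rewrite /g.
have := @mul_bin_sub n r l; rewrite -ltnS lr rn => /(_ isT) /(congr1 (fun i => i%:R : R)).
rewrite !natrM => binE; rewrite -mulr_natl.
have -> : ('C(n - l, r - l))%:R = ('C(n, r))%:R * ('C(r, l))%:R / ('C(n, l))%:R :> R.
  by apply: (mulfI Cnl); rewrite -binE; field.
field.
by rewrite Cnl expf_neq0 // gt_eqF.
Qed.

(** [X] counts the cliques of size [r] and [I] the ordered pairs of them that meet. Disjoint pairs
    are independent and contribute at most [mu ^+ 2] to the mean of [X ^+ 2]. The quadratic bound on
    the bad event then has mean at most twice that of [I], and dividing by [mu ^+ 2 / 2] gives the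
    factor 4. *)
Lemma prob_no_disjoint_cliques_le r : (r <= n)%N ->
  prob_graph p (fun E => ~ disjoint_cliques E r) <= 4 * overlap_sum r.
Proof.
move=> rn; pose mu : R := ('C(n, r))%:R * p ^+ 'C(r, 2).
have mu_gt0 : 0 < mu by rewrite mulr_gt0 ?exprn_gt0 // ltr0n bin_gt0.
pose X E : R := \sum_(S : {set 'I_n} | #|S| == r) (clique E S)%:R.
pose I E : R := \sum_(S : {set 'I_n} | #|S| == r)
   \sum_(T : {set 'I_n} | (#|T| == r) && ~~ [disjoint S & T]) (clique E S && clique E T)%:R.
have X2E E : X E ^+ 2 = I E + \sum_(S : {set 'I_n} | #|S| == r)
    \sum_(T : {set 'I_n} | (#|T| == r) && [disjoint S & T]) (clique E S && clique E T)%:R.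
  rewrite expr2 /X big_distrlr /= /I -big_split; apply: eq_bigr => S _ /=.
  rewrite [LHS](bigID (fun T => ~~ [disjoint S & T])) /=; congr (_ + _).
    by apply: eq_bigr => T _; rewrite -natrM mulnb.
  rewrite (eq_bigl (fun T : {set 'I_n} => (#|T| == r) && [disjoint S & T])); last first.
    by move=> T; rewrite negbK.
  by apply: eq_bigr => T _; rewrite -natrM mulnb.
have EX : expectation X = mu.
  rewrite expectation_sum (eq_bigr (fun=> p ^+ 'C(r, 2))).
    by rewrite sumr_const card_draws_pred card_ord /mu mulr_natl.
  by move=> S /eqP Sr; rewrite expectation_clique Sr.
have EI : expectation I <= mu ^+ 2 * overlap_sum r.
  rewrite expectation_sum.
  apply: (@le_trans _ _ (\sum_(S : {set 'I_n} | #|S| == r)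
      ('C(n, r))%:R * p ^+ 'C(r, 2) ^+ 2 * overlap_sum r)).
    apply: ler_sum => S /eqP Sr; rewrite expectation_sum.
    apply: le_trans (sum_overlapping_le rn Sr).
    by apply: ler_sum => T /andP[/eqP Tr _]; rewrite expectation_clique2 Sr Tr.
  rewrite sumr_const card_draws_pred card_ord -mulr_natl /mu le_eqVlt; apply/orP; left.
  by apply/eqP; ring.
have EX2 : expectation (fun E => X E ^+ 2) <= expectation I + mu ^+ 2.
  under [X in X <= _]eq_bigr do rewrite X2E.
  rewrite -/(expectation _) expectationD lerD2l expectation_sum.
  apply: (@le_trans _ _ (\sum_(S : {set 'I_n} | #|S| == r)
      \sum_(T : {set 'I_n} | #|T| == r) p ^+ 'C(r, 2) ^+ 2)).
    apply: ler_sum => S /eqP Sr; rewrite expectation_sum big_mkcondr.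
    apply: ler_sum => T /eqP Tr; case: ifP => [dST|_]; last by rewrite !exprn_ge0 // ltW.
    rewrite expectation_clique2 Sr Tr disjoint_setI0 // cards0 subn0.
    by rewrite -exprM muln2 -addnn.
  rewrite !sumr_const !card_draws_pred card_ord -mulr_natl -[X in _ * X]mulr_natl.
  by rewrite /mu le_eqVlt; apply/orP; left; apply/eqP; ring.
(* On the bad event [X ^ 2 = I], and [(X - mu) ^ 2 + X ^ 2 >= mu ^ 2 / 2]. *)
have bound : mu ^+ 2 / 2 * prob_graph p (fun E => ~ disjoint_cliques E r) <=
    expectation (fun E => (X E ^+ 2 + (- 2 * mu) * X E) + (mu ^+ 2 + I E)).
  rewrite prob_graphE -expectationZ; apply: le_expectation => E _.
  have I_ge0 : 0 <= I E by apply: sumr_ge0 => S _; apply: sumr_ge0.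
  case: asboolP => [bad|_] /=; last first.
    by have := sqr_ge0 (X E - mu); nra.
  have -> : I E = X E ^+ 2.
    rewrite X2E [X in _ + X]big1 ?addr0 // => S /eqP Sr; rewrite big1 // => T /andP[/eqP Tr dST].
    by case: (boolP (_ && _)) => // /andP[cS cT]; case: bad; exists S, T.
  by have := sqr_ge0 (2 * X E - mu); nra.
rewrite !expectationD expectationZ expectation_cst EX in bound.
have mu2 : 0 < mu ^+ 2 by rewrite exprn_gt0.
rewrite -(ler_pM2l (_ : 0 < mu ^+ 2 / 2)); last by rewrite divr_gt0.
apply: (le_trans bound); nra.
Qed.

End RandomGraph.
End RandomGraphs.

(** * Asymptotic estimates *)

Section BinomialEstimates.
Variable R : realType.

Lemma bin2_real (l : nat) : ('C(l, 2))%:R = l%:R * (l%:R - 1) / 2 :> R.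
Proof.
elim: l => [|l IH]; first by rewrite bin0n !mul0r.
by rewrite binS bin1 natrD IH -natr1; field.
Qed.

(** Stirling-type bound [e r (r / e) ^ r]; the inductive step rests on
    [(s / (s + 1)) ^ (s + 1) <= 1 / e]. *)
Lemma fact_le (r : nat) : (0 < r)%N -> (r`!)%:R <= r%:R * expR (1 - r%:R) * r%:R ^+ r :> R.
Proof.
elim: r => // -[_ _|r IH _]; first by rewrite subrr expR0 expr1n !mulr1.
set s : R := r.+1%:R; have s_gt0 : 0 < s by rewrite ltr0n.
have IH' : (r.+1`!)%:R <= s * expR (1 - s) * s ^+ r.+1 := IH isT.
have s1E : r.+2%:R = s + 1 :> R by rewrite -natr1.
have s1_gt0 : 0 < s + 1 by rewrite addr_gt0.
rewrite factS natrM s1E -mulrA ler_pM2l //.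
apply: (le_trans IH').
have h : s / (s + 1) <= expR (- (s + 1)^-1).
  apply: le_trans (expR_ge1Dx _); rewrite le_eqVlt; apply/orP; left.
  by apply/eqP; field; rewrite gt_eqF.
have h2 : (s / (s + 1)) ^+ r.+2 <= expR (- 1).
  apply: (@le_trans _ _ (expR (- (s + 1)^-1) ^+ r.+2)).
    by rewrite lerXn2r // nnegrE ?expR_ge0 // divr_ge0 ?ltW.
  rewrite -expRM_natl s1E mulrN divff ?gt_eqF //.
rewrite expr_div_n ler_pdivrMr ?exprn_gt0 // in h2.
have -> : 1 - (s + 1) = (1 - s) + (- 1) by ring.
have -> : s * expR (1 - s) * s ^+ r.+1 = expR (1 - s) * s ^+ r.+2.
  by rewrite [in RHS]exprS; ring.
by rewrite (expRD (1 - s)) -mulrA; apply: ler_wpM2l; rewrite ?expR_ge0.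
Qed.

(** The companion bound [(r / e) ^ r <= r!], by induction from [(1 + 1 / s) ^ s <= e]. *)
Lemma fact_ge (r : nat) : r%:R ^+ r <= (r`!)%:R * expR r%:R :> R.
Proof.
elim: r => [|r IH]; first by rewrite expr0 fact0 expR0 mulr1.
have [->|r_gt0] := posnP r; first by rewrite expr1 mul1r (le_trans _ (expR_ge1Dx _)) // lerDr.
set s : R := r%:R; have s_gt0 : 0 < s by rewrite ltr0n.
have s1E : r.+1%:R = s + 1 :> R by rewrite -natr1.
have s1_gt0 : 0 < s + 1 by rewrite addr_gt0.
rewrite factS natrM s1E exprS -mulrA ler_pM2l // expRD mulrA.
apply: (@le_trans _ _ (s ^+ r * expR 1)); last by rewrite ler_wpM2r ?expR_ge0.
have h : (s + 1) / s <= expR s^-1.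
  apply: le_trans (expR_ge1Dx _); rewrite le_eqVlt; apply/orP; left.
  by apply/eqP; field; rewrite gt_eqF.
have h2 : ((s + 1) / s) ^+ r <= expR 1.
  apply: (@le_trans _ _ (expR s^-1 ^+ r)).
    by rewrite lerXn2r // nnegrE ?expR_ge0 // divr_ge0 ?ltW.
  by rewrite -expRM_natl divff ?gt_eqF.
by rewrite expr_div_n ler_pdivrMr ?exprn_gt0 // mulrC in h2.
Qed.

(** The falling factorial is [n ^ l] times a product of factors [1 - i / n], which is at least
    [1 - l ^ 2 / n]; both sides are multiplied by [n] to avoid the division. *)
Lemma ffact_ge (n l : nat) : (l <= n)%N ->
  n%:R ^+ l * (n%:R - l%:R ^+ 2) <= (n ^_ l)%:R * n%:R :> R.
Proof.
elim: l => [|l IH] ln; first by rewrite expr0 ffactn0 expr0n subr0.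
have {}IH := IH (ltnW ln).
rewrite ffactnSr natrM natrB 1?ltnW // exprS -natr1.
set N : R := n%:R in IH *; set s : R := l%:R in IH *.
have s_ge0 : 0 <= s by [].
have Ns : s <= N by rewrite ler_nat ltnW.
have N_ge0 : 0 <= N by [].
have P_ge0 : 0 <= N ^+ l by rewrite exprn_ge0.
set P := N ^+ l in IH P_ge0 *; set F := (n ^_ l)%:R in IH *.
have h : P * (N - s ^+ 2) * (N - s) <= F * N * (N - s) by rewrite ler_wpM2r // subr_ge0.
have -> : F * (N - s) * N = F * N * (N - s) by ring.
apply: le_trans h; rewrite -[N * P]mulrC -!mulrA ler_wpM2l //.
suff : 0 <= s ^+ 3 + N * (s + 1) by nra.
by rewrite addr_ge0 ?exprn_ge0 // mulr_ge0 // addr_ge0.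
Qed.

Lemma inv_bin_le (n l : nat) : (0 < n)%N -> (2 * l ^ 2 <= n)%N ->
  ('C(n, l))%:R^-1 <= 2 * (l`!)%:R / n%:R ^+ l :> R.
Proof.
move=> n_gt0 l2n; have ln : (l <= n)%N.
  apply: leq_trans l2n; case: l => // l; rewrite -mulnn; nia.
have N_gt0 : 0 < n%:R :> R by rewrite ltr0n.
have B_gt0 : 0 < ('C(n, l))%:R :> R by rewrite ltr0n bin_gt0.
have P_gt0 : 0 < n%:R ^+ l :> R by rewrite exprn_gt0.
rewrite ler_pdivlMr // ler_pdivrMl //.
have := ffact_ge ln; rewrite -bin_ffact natrM.
have : (2 * l%:R ^+ 2 <= n%:R :> R) by rewrite -natrX -natrM ler_nat.
set F : R := (l`!)%:R; set B : R := ('C(n, l))%:R; set N : R := n%:R; set P := N ^+ l.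
move=> h1 h2; rewrite -(ler_pM2r N_gt0).
have : 0 <= P * (N - 2 * l%:R ^+ 2) by rewrite mulr_ge0 ?subr_ge0 // ltW.
nra.
Qed.

Lemma bin_le_pow (r k : nat) : ('C(r, k) <= r ^ k)%N.
Proof.
apply: (@leq_trans (r ^_ k)); first by rewrite -bin_ffact leq_pmulr // fact_gt0.
elim: k => [|k IH]; first by rewrite ffactn0.
by rewrite ffactnSr expnSr leq_mul // leq_subr.
Qed.

Lemma bin_fact_le_pow (r k : nat) : ('C(r, k) * k`! <= r ^ k)%N.
Proof.
rewrite bin_ffact; elim: k => [|k IH]; first by rewrite ffactn0.
by rewrite ffactnSr expnSr leq_mul // leq_subr.
Qed.

Variables (lam : R) (n r : nat).
Hypotheses (lam_gt0 : 0 < lam) (n_gt0 : (0 < n)%N) (r_gt0 : (0 < r)%N) (r2n : (2 * r ^ 2 <= n)%N).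

(** Here [lam] stands for [- ln p]. The [l]-th power of [small_overlap] controls overlaps of at most
    half of [r]; [full_overlap] is the inverse of [n ^ r / r!] times [p ^ 'C(r, 2)], roughly the
    mean number of cliques of size [r]. *)
Let small_overlap := r%:R ^+ 2 * expR (lam * (r%:R / 4)) / n%:R.
Let full_overlap := (r`!)%:R * expR (lam * ('C(r, 2))%:R) / n%:R ^+ r.

Lemma overlap_term_le l : (0 < l)%N -> (2 * l ^ 2 <= n)%N ->
  ('C(r, l))%:R ^+ 2 / ('C(n, l))%:R * expR (lam * ('C(l, 2))%:R) <=
  2 * (('C(r, l))%:R ^+ 2 * (l`!)%:R * expR (lam * ('C(l, 2))%:R) / n%:R ^+ l).
Proof.
move=> l_gt0 l2n; have := @inv_bin_le n l n_gt0 l2n.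
set B := (_)^-1; set C := _ ^+ 2; set e := expR _; set F := (l`!)%:R; set N := n%:R ^+ l.
have -> : 2 * (C * F * e / N) = C * (2 * F / N) * e by ring.
move=> h; apply: ler_wpM2r; first exact: expR_ge0.
by apply: ler_wpM2l => //; rewrite exprn_ge0.
Qed.

Lemma overlap_term_small l : (0 < l)%N -> (2 * l <= r)%N -> small_overlap <= 1 ->
  ('C(r, l))%:R ^+ 2 / ('C(n, l))%:R * expR (lam * ('C(l, 2))%:R) <= 2 * small_overlap.
Proof.
move=> l_gt0 lr b1.
have N_gt0 : 0 < n%:R :> R by rewrite ltr0n.
have b_ge0 : 0 <= small_overlap.
  by rewrite /small_overlap divr_ge0 // mulr_ge0 ?expR_ge0 // exprn_ge0.
have l2n : (2 * l ^ 2 <= n)%N.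
  by apply: leq_trans r2n; rewrite leq_mul2l /= leq_exp2r //; lia.
apply: (le_trans (overlap_term_le l_gt0 l2n)); rewrite ler_pM2l //.
(* A base at most 1 bounds its own positive powers; [2 * l <= r] bounds the exponent [(l - 1) / 2]
   by [r / 4]. *)
apply: (@le_trans _ _ (small_overlap ^+ l)); last exact: ler_iXnr.
rewrite /small_overlap expr_div_n exprMn ler_pM2r ?invr_gt0 ?exprn_gt0 //.
apply: ler_pM; rewrite ?expR_ge0 ?mulr_ge0 ?exprn_ge0 //.
  rewrite exprAC !expr2 -mulrA -!natrX -!natrM ler_nat.
  by rewrite leq_mul ?bin_le_pow ?bin_fact_le_pow.
rewrite -expRM_natl ler_expR bin2_real.
have l4 : (l%:R - 1) / 2 <= r%:R / 4 :> R.
  have : (2 * l%:R <= r%:R :> R) by rewrite -natrM ler_nat.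
  lra.
have := ler_wpM2l (mulr_ge0 (ltW lam_gt0) (ler0n R l)) l4.
by rewrite !mulrA [l%:R * lam]mulrC.
Qed.

(** Lowering a full overlap by [k = r - l] vertices costs a factor of at most [b ^+ k], where [b] is
    the left side of the last hypothesis: as [2 * k <= r], ['C(r - k, 2)] is at most
    ['C(r, 2) + k * (1 / 2 - 3 / 4 * r)]. *)
Lemma overlap_term_large l : (l <= r)%N -> (r < 2 * l)%N ->
  r%:R * n%:R * expR (lam * (2^-1 - 3 / 4 * r%:R)) <= 1 ->
  ('C(r, l))%:R ^+ 2 / ('C(n, l))%:R * expR (lam * ('C(l, 2))%:R) <= 2 * full_overlap.
Proof.
move=> lr rl b1.
have N_gt0 : 0 < n%:R :> R by rewrite ltr0n.
have r_gt0' : 0 < r%:R :> R by rewrite ltr0n.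
have l_gt0 : (0 < l)%N by lia.
have l2n : (2 * l ^ 2 <= n)%N by apply: leq_trans r2n; rewrite leq_mul2l /= leq_exp2r.
apply: (le_trans (overlap_term_le l_gt0 l2n)); rewrite ler_pM2l //.
pose k := (r - l)%N; have lE : l = (r - k)%N by rewrite /k subKn.
have kr : (k <= r)%N by exact: leq_subr.
set b := _ * expR _ in b1.
have b_ge0 : 0 <= b by rewrite mulr_ge0 ?expR_ge0 // mulr_ge0.
have bk1 : b ^+ k <= 1 by exact: exprn_ile1.
apply: (@le_trans _ _ (full_overlap * b ^+ k)); last first.
  rewrite ler_piMr // /full_overlap divr_ge0 ?exprn_ge0 // mulr_ge0 ?expR_ge0 //.
have -> : full_overlap * b ^+ k = (r%:R ^+ k * (r`!)%:R) *
    expR (lam * ('C(r, 2))%:R + k%:R * (lam * (2^-1 - 3 / 4 * r%:R))) / n%:R ^+ l.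
  rewrite /full_overlap /b !exprMn expRD expRM_natl -[in n%:R ^+ r](subnK lr) -/k exprD.
  field; by rewrite !expf_neq0 // gt_eqF.
rewrite ler_pM2r ?invr_gt0 ?exprn_gt0 //.
apply: ler_pM; rewrite ?expR_ge0 ?mulr_ge0 ?exprn_ge0 //.
  rewrite lE bin_sub // -!natrX -!natrM ler_nat -mulnn -mulnA leq_mul ?bin_le_pow //.
  rewrite -[leqRHS](bin_fact kr) leq_mul2l; apply/orP; right.
  by rewrite leq_pmull // fact_gt0.
have lE' : l%:R = r%:R - k%:R :> R by rewrite lE natrB.
have kr2 : (2 * k%:R <= r%:R :> R) by rewrite -natrM ler_nat /k; lia.
have k_ge0 : 0 <= k%:R :> R by [].
rewrite ler_expR !bin2_real lE' [k%:R * _]mulrCA -(mulrDr lam) ler_pM2l //.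
set x : R := r%:R in kr2 *; set y : R := k%:R in kr2 k_ge0 *.
suff : 0 <= y * (x / 4 - y / 2) by nra.
by apply: mulr_ge0 => //; lra.
Qed.

End BinomialEstimates.

(** * Moments near the threshold *)

Section Asymptotics.
Local Open Scope classical_set_scope.
Variables (R : realType) (lam eps : R).

Lemma full_overlap_le (x : R) (n r : nat) : 0 < x -> n%:R = expR (lam * x) -> (0 < r)%N ->
  r%:R <= 2 * x ->
  lam * ((r%:R - 1) / 2) <= lam * x - ln x + (1 - ln 2) - lam * eps / 2 ->
  (r`!)%:R * expR (lam * ('C(r, 2))%:R) / n%:R ^+ r <=
  expR 1 * r%:R * expR (- (lam * eps / 2 * r%:R)).
Proof.
move=> x_gt0 nE r_gt0 rx hr.
have n_gt0 : 0 < n%:R :> R by rewrite nE expR_gt0.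
have r_ge0 : 0 <= r%:R :> R by [].
(* By [fact_le] the quantity is at most [e * r * y ^ r]. Since [r <= 2 * x], the last hypothesis
   makes [y] at most [expR (- (lam * eps / 2))]. *)
set y := expR (- 1) * r%:R * expR (lam * ((r%:R - 1) / 2)) / n%:R.
have y_ge0 : 0 <= y by rewrite /y !(mulr_ge0, expR_ge0, invr_ge0, ler0n).
have y_le : y <= expR (- (lam * eps / 2)).
  apply: (@le_trans _ _ (expR (- 1) * (2 * x) * expR (lam * x - ln x + (1 - ln 2) - lam * eps / 2) / n%:R)).
    rewrite ler_pM2r ?invr_gt0 //; apply: ler_pM; rewrite ?(mulr_ge0, expR_ge0, ler0n, ler_expR) //.
    by rewrite ler_pM2l ?expR_gt0.
  have -> : 2 * x = expR (ln 2 + ln x) by rewrite expRD !lnK ?posrE.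
  by rewrite nE -expRN -!expRD ler_expR; lra.
apply: (@le_trans _ _ (expR 1 * r%:R * y ^+ r)); last first.
  have -> : - (lam * eps / 2 * r%:R) = r%:R * (- (lam * eps / 2)) by ring.
  rewrite expRM_natl; apply: ler_wpM2l; first by rewrite mulr_ge0 ?expR_ge0.
  by rewrite lerXn2r // nnegrE expR_ge0.
have -> : expR 1 * r%:R * y ^+ r = (r%:R * expR (1 - r%:R) * r%:R ^+ r) *
    expR (lam * ('C(r, 2))%:R) / n%:R ^+ r.
  rewrite /y expr_div_n !exprMn -!expRM_natl bin2_real expRD.
  have -> : r%:R * -1 = - r%:R :> R by ring.
  have -> : r%:R * (lam * ((r%:R - 1) / 2)) = lam * (r%:R * (r%:R - 1) / 2) by ring.
  by ring.
rewrite ler_pM2r ?invr_gt0 ?exprn_gt0 // ler_pM2r ?expR_gt0 //.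
exact: fact_le.
Qed.

Lemma clique_expectation_le (x : R) (n k : nat) : 0 < x -> n%:R = expR (lam * x) -> (0 < k)%N ->
  2 * x * expR (- (lam * eps / 4)) <= k%:R ->
  lam * x - ln x + (1 - ln 2) + lam * eps / 2 <= lam * ((k%:R - 1) / 2) ->
  ('C(n, k))%:R * expR (- (lam * ('C(k, 2))%:R)) <= expR (- (lam * eps / 4 * k%:R)).
Proof.
move=> x_gt0 nE k_gt0 kx hk.
have k_gt0' : 0 < k%:R :> R by rewrite ltr0n.
have n_gt0 : 0 < n%:R :> R by rewrite nE expR_gt0.
(* ['C(n, k) <= (n * e / k) ^ k] bounds the expectation by [y ^ k]. Half of the gain [lam * eps / 2]
   pays for [k] possibly falling slightly short of [2 * x]. *)
set y := n%:R * expR 1 / k%:R * expR (- (lam * ((k%:R - 1) / 2))).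
have y_ge0 : 0 <= y by rewrite /y !(mulr_ge0, expR_ge0, invr_ge0, ler0n).
have y_le : y <= expR (- (lam * eps / 4)).
  have x2_gt0 : 0 < 2 * x * expR (- (lam * eps / 4)) by rewrite !mulr_gt0 ?expR_gt0.
  apply: (@le_trans _ _ (n%:R * expR 1 / (2 * x * expR (- (lam * eps / 4))) *
      expR (- (lam * x - ln x + (1 - ln 2) + lam * eps / 2)))).
    apply: ler_pM; rewrite ?expR_ge0 ?ler_expR ?lerN2 //.
    apply: ler_wpM2l; first by rewrite mulr_ge0 ?expR_ge0 // ltW.
    by rewrite lef_pV2 ?posrE.
  have -> : 2 * x = expR (ln 2 + ln x) by rewrite expRD !lnK ?posrE.
  by rewrite nE -!expRD -expRN -!expRD ler_expR; lra.
apply: (@le_trans _ _ (y ^+ k)); last first.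
  have -> : - (lam * eps / 4 * k%:R) = k%:R * (- (lam * eps / 4)) by ring.
  by rewrite expRM_natl lerXn2r // nnegrE expR_ge0.
have -> : y ^+ k = n%:R ^+ k * expR k%:R / k%:R ^+ k * expR (- (lam * ('C(k, 2))%:R)).
  rewrite /y !exprMn exprVn -!expRM_natl mulr1 bin2_real; congr (_ * expR _); ring.
rewrite ler_pM2r ?expR_gt0 // ler_pdivlMr ?exprn_gt0 //.
apply: (@le_trans _ _ (('C(n, k))%:R * ((k`!)%:R * expR k%:R))).
  by apply: ler_wpM2l; rewrite ?fact_ge.
rewrite mulrA ler_pM2r ?expR_gt0 // -natrM -natrX ler_nat.
exact: bin_fact_le_pow.
Qed.

Lemma cvg_pow_expR (k : nat) (c : R) : 0 < c -> (x ^+ k * expR (- (c * x))) @[x --> +oo] --> (0 : R).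
Proof.
(* With [u = c * x / (k + 1)], the bound [u ^ (k + 1) <= expR (c * x)] leaves a spare factor
   [1 / x]. *)
move=> c_gt0; pose K := (k.+1%:R / c) ^+ k.+1.
have K_gt0 : 0 < K by rewrite exprn_gt0 // divr_gt0.
have bound x : 0 < x -> x ^+ k * expR (- (c * x)) <= K * x^-1.
  move=> x_gt0; have kc : (c * x / k.+1%:R) ^+ k.+1 <= expR (c * x).
    set u := c * x / _; have -> : c * x = k.+1%:R * u by rewrite /u [RHS]mulrC divfK ?pnatr_eq0.
    have u_ge0 : 0 <= u by rewrite /u divr_ge0 // mulr_ge0 // ltW.
    rewrite expRM_natl lerXn2r // ?nnegrE ?expR_ge0 //.
    by apply: le_trans (expR_ge1Dx _); rewrite lerDr.
  rewrite expRN ler_pdivrMr ?expR_gt0 //.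
  apply: (@le_trans _ _ (K / x * (c * x / k.+1%:R) ^+ k.+1)); last first.
    by rewrite ler_pM2l ?divr_gt0.
  rewrite /K -mulrA [_^-1 * _]mulrC mulrA -exprMn le_eqVlt; apply/orP; left; apply/eqP.
  have -> : k.+1%:R / c * (c * x / k.+1%:R) = x.
    by field; rewrite nat1r pnatr_eq0 /= gt_eqF.
  by rewrite exprS [RHS]mulrC mulKf // gt_eqF.
apply: (@squeeze_cvgr _ _ _ _ (fun=> 0) (fun x => K * x^-1)).
- near=> x; have x_gt0 : 0 < x by near: x; exact: nbhs_pinfty_gt.
  by rewrite bound // mulr_ge0 ?expR_ge0 // exprn_ge0 // ltW.
- exact: cvg_cst.
- have pos : \forall x \near +oo, 0 < (x : R) by exact: nbhs_pinfty_gt.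
  have xV : x^-1 @[x --> +oo] --> (0 : R) by exact/(gtr0_cvgV0 pos)/cvg_id.
  by rewrite -[X in _ --> X](mulr0 K); apply: cvgM xV; exact: cvg_cst.
Unshelve. all: by end_near. Qed.

End Asymptotics.

(** * Probability of failure *)

Section ProbabilityEstimate.
Local Open Scope classical_set_scope.
Variable R : realType.
Implicit Types lam eps x : R.

(** [zfun] in terms of [x = log_q n] and [lam = ln q]. *)
Definition clique_scale lam x : R :=
  2 * x - 2 * (ln x / lam) + 2 * ((1 - ln 2) / lam) + 1.

(** The terms come, in order, from cliques above the upper threshold, from overlaps of at most half
    of [r], and from larger overlaps. *)
Definition failure_bound lam eps x : R :=
  expR (- (3 / 8 * lam * eps * x)) +
  64 * (x ^+ 3 * expR (- (lam / 2 * x))) +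
  32 * expR 1 * (x ^+ 2 * expR (- (3 / 4 * lam * eps * x))).

Lemma cvg_failure_bound lam eps : 0 < lam -> 0 < eps ->
  failure_bound lam eps x @[x --> +oo] --> (0 : R).
Proof.
move=> lam_gt0 eps_gt0; have -> : 0 = 0 + 64 * 0 + 32 * expR 1 * 0 :> R by ring.
apply: cvgD; first apply: cvgD.
- have := @cvg_pow_expR R 0 (3 / 8 * lam * eps); rewrite !mulr_gt0 // => /(_ isT).
  by under eq_fun do rewrite expr0 mul1r.
- by apply: cvgM; [exact: cvg_cst|apply: cvg_pow_expR; rewrite divr_gt0].
- by apply: cvgM; [exact: cvg_cst|apply: cvg_pow_expR; rewrite !mulr_gt0].
Qed.

Lemma near_pow_expR_le (k : nat) (c d : R) : 0 < c -> 0 < d ->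
  \forall x \near +oo, x ^+ k * expR (- (c * x)) <= d.
Proof.
by move=> c_gt0 d_gt0; have /cvgr_le := cvg_pow_expR k c_gt0; apply.
Qed.

Lemma near_ln_le (d : R) : 0 < d -> \forall x \near +oo, ln x <= d * x.
Proof.
move=> d_gt0; near=> x.
have x_gt0 : 0 < x by near: x; exact: nbhs_pinfty_gt.
rewrite -ler_expR lnK ?posrE // -[leRHS]mul1r -ler_pdivrMr ?expR_gt0 // -expRN.
by near: x; exact: (near_pow_expR_le 1 d_gt0 ltr01).
Unshelve. all: by end_near. Qed.

(** Largeness of [n] is expressed through the real [x] alone. As the scale is [2 * x] up to a
    logarithm, [r] and [c.+1] are at least [3 / 2 * x], which turns the moment bounds into
    exponentials in [x]. *)
Lemma clique_prob_estimate lam eps (p : R) : 0 < lam -> 0 < eps -> eps < 1 -> p = expR (- lam) ->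
  \forall x \near +oo, forall n : nat, n%:R = expR (lam * x) -> exists r c : nat,
  [/\ Num.floor (clique_scale lam x - eps) = r%:Z, Num.floor (clique_scale lam x + eps) = c%:Z &
   prob_graph p (fun E => exists2 S : {set 'I_n}, #|S| = c.+1 & clique E S) +
   prob_graph p (fun E : {set 'I_n * 'I_n} => ~ disjoint_cliques E r) <= failure_bound lam eps x].
Proof.
move=> lam_gt0 eps_gt0 eps_lt1 pE.
have p_gt0 : 0 < p by rewrite pE expR_gt0.
have p_lt1 : p < 1 by rewrite pE expR_lt1 oppr_lt0.
have pV (k : nat) : p ^- k = expR (lam * k%:R).
  by rewrite pE -expRM_natl -expRN; congr expR; ring.
have pX (k : nat) : p ^+ k = expR (- (lam * k%:R)).
  by rewrite pE -expRM_natl; congr expR; ring.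
have gap_gt0 : 0 < 1 - expR (- (lam * eps / 4)).
  by rewrite subr_gt0 expR_lt1 oppr_lt0 divr_gt0 // mulr_gt0.
have e_gt0 (y : R) := expR_gt0 y.
near=> x => n nE.
have x4 : 4 <= x by near: x; exact: nbhs_pinfty_ge.
(* Makes [ln x / lam] at most [x / 8], hence the scale at least [7 / 4 * x + 1]. *)
have ln8 : ln x <= lam / 8 * x by near: x; apply: near_ln_le; rewrite divr_gt0.
(* Gives [c.+1] the lower bound [2 * x * expR (- (lam * eps / 4))] that [clique_expectation_le] asks
   for. *)
have lngap : ln x <= lam * (1 - expR (- (lam * eps / 4))) * x.
  by near: x; apply: near_ln_le; rewrite mulr_gt0.
(* Yields [r <= 2 * x]: the constant part of the scale is absorbed by its term in [ln x]. *)
have ln_large : 1 - ln 2 + lam / 2 <= ln x.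
  rewrite -ler_expR lnK ?posrE; last by apply: lt_le_trans x4.
  by near: x; exact: nbhs_pinfty_ge.
have small1 : x ^+ 2 * expR (- (lam / 2 * x)) <= 8^-1.
  by near: x; apply: near_pow_expR_le; rewrite ?divr_gt0.
have small2 : x ^+ 1 * expR (- (lam / 8 * x)) <= (2 * expR (lam / 2))^-1.
  by near: x; apply: near_pow_expR_le; rewrite ?invr_gt0 ?mulr_gt0 ?divr_gt0.
have x_gt0 : 0 < x by apply: lt_le_trans x4.
have ln2_le1 : ln 2 <= 1 :> R.
  by have := @le_ln1Dx R 1; rewrite (_ : 1 + 1 = 2 :> R) //; apply; apply: lt_trans ltr01; rewrite oppr_lt0.
have scale_ge : 2 * x - 2 * (ln x / lam) + 1 <= clique_scale lam x.
  by rewrite /clique_scale lerD2r lerDl mulr_ge0 // divr_ge0 ?subr_ge0 // ltW.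
have ln4 : ln x / lam <= x / 8.
  by rewrite ler_pdivrMr //; move: (ln8); clear; lra.
have scale_lo : 7 / 4 * x + 1 <= clique_scale lam x.
  by move: (scale_ge) (ln4) (x_gt0); clear; lra.
have [r rE] : exists r : nat, Num.floor (clique_scale lam x - eps) = r%:Z.
  have : 0 <= Num.floor (clique_scale lam x - eps) by rewrite floor_ge0; move: (scale_lo) (x_gt0) (eps_gt0) (eps_lt1); clear; lra.
  by case: Num.floor => // r _; exists r.
have [c cE] : exists c : nat, Num.floor (clique_scale lam x + eps) = c%:Z.
  have : 0 <= Num.floor (clique_scale lam x + eps) by rewrite floor_ge0; move: (scale_lo) (x_gt0) (eps_gt0) (eps_lt1); clear; lra.
  by case: Num.floor => // c _; exists c.
exists r, c; split => //.
have r_le : r%:R <= clique_scale lam x - eps by have := ge_floor (clique_scale lam x - eps); rewrite rE.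
have r_gt : clique_scale lam x - eps < r%:R + 1.
  by have := lt_succ_floor (clique_scale lam x - eps); rewrite rE intrD.
have c_gt : clique_scale lam x + eps < c.+1%:R.
  by have := lt_succ_floor (clique_scale lam x + eps); rewrite cE intrD -natr1.
have r_lo : 3 / 2 * x <= r%:R by move: (scale_lo) (r_gt) (x4) (eps_lt1); clear; lra.
have c_lo : 3 / 2 * x <= c.+1%:R by move: (scale_lo) (c_gt) (x_gt0) (eps_gt0); clear; lra.
have r_hi : r%:R <= 2 * x.
  apply: (le_trans r_le).
  suff : 2 * ((1 - ln 2) / lam) + 1 <= 2 * (ln x / lam) by rewrite /clique_scale; move: (eps_gt0); clear; lra.
  have -> : 2 * ((1 - ln 2) / lam) + 1 = 2 * ((1 - ln 2 + lam / 2) / lam).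
    by field; rewrite gt_eqF.
  by rewrite ler_pM2l // ler_pM2r ?invr_gt0.
have r_gt0 : (0 < r)%N by rewrite -(ltr0n R) (lt_le_trans _ r_lo) // mulr_gt0 // divr_gt0.
have n_gt0 : (0 < n)%N by rewrite -(ltr0n R) nE.
have r_ge0 : 0 <= r%:R :> R by [].
have r2_le : r%:R ^+ 2 <= 4 * x ^+ 2 :> R by move: (r_ge0) (r_hi); clear; nra.
have r2n : (2 * r ^ 2 <= n)%N.
  rewrite -(ler_nat R) natrM natrX nE.
  have : x ^+ 2 * expR (- (lam / 2 * x)) * expR (lam * x) <= 8^-1 * expR (lam * x) by rewrite ler_pM2r.
  rewrite -mulrA -expRD.
  have h : x ^+ 2 <= x ^+ 2 * expR (- (lam / 2 * x) + lam * x).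
    rewrite ler_peMr ?exprn_ge0 ?ltW // expR_gt1; move: (lam_gt0) (x_gt0); clear; nra.
  by move: h r2_le; set a := x ^+ 2; set b := x ^+ 2 * _; set d := expR _; clear; lra.
have rn : (r <= n)%N by apply: leq_trans r2n; rewrite (leq_trans (leq_pmulr r r_gt0)) // mulnn leq_pmull.
have small_le : r%:R ^+ 2 * expR (lam * (r%:R / 4)) / n%:R <= 4 * (x ^+ 2 * expR (- (lam / 2 * x))).
  rewrite nE -expRN -mulrA -expRD mulrA; apply: ler_pM; rewrite ?exprn_ge0 ?expR_ge0 //.
  by rewrite ler_expR; move: (lam_gt0) (r_hi); clear; nra.
have full_le : (r`!)%:R * expR (lam * ('C(r, 2))%:R) / n%:R ^+ r <=
    2 * expR 1 * (x * expR (- (3 / 4 * lam * eps * x))).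
  apply: le_trans (@full_overlap_le R lam eps x n r x_gt0 nE r_gt0 r_hi _) _.
    have : lam * ((r%:R - 1) / 2) <= lam * ((clique_scale lam x - eps - 1) / 2).
      by rewrite ler_pM2l // ler_pM2r ?invr_gt0 // lerD2r.
    have -> : lam * ((clique_scale lam x - eps - 1) / 2) = lam * x - ln x + (1 - ln 2) - lam * eps / 2.
      by rewrite /clique_scale; field; rewrite gt_eqF.
    by [].
  have -> : 2 * expR 1 * (x * expR (- (3 / 4 * lam * eps * x))) =
     expR 1 * (2 * x) * expR (- (3 / 4 * lam * eps * x)) by ring.
  apply: ler_pM; rewrite ?expR_ge0 ?mulr_ge0 ?expR_ge0 //.
    by rewrite ler_pM2l.
  have le_pos : 0 < lam * eps by rewrite mulr_gt0.
  by rewrite ler_expR lerN2; move: (le_pos) (r_lo); clear; nra.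
have large1 : r%:R * n%:R * expR (lam * (2^-1 - 3 / 4 * r%:R)) <= 1.
  apply: (@le_trans _ _ (2 * expR (lam / 2) * (x ^+ 1 * expR (- (lam / 8 * x))))); last first.
    by rewrite -ler_pdivlMl ?mulr_gt0 // mulr1.
  have -> : 2 * expR (lam / 2) * (x ^+ 1 * expR (- (lam / 8 * x))) =
      (2 * x) * (expR (lam / 2) * expR (- (lam / 8 * x))) by ring.
  rewrite nE -mulrA -!expRD; apply: ler_pM; rewrite ?expR_ge0 //.
  by rewrite ler_expR; move: (lam_gt0) (r_lo); clear; nra.
rewrite /failure_bound -addrA; apply: lerD.
  apply: le_trans (prob_clique_le _ p_gt0 p_lt1 _) _.
  rewrite pX; apply: le_trans (@clique_expectation_le R lam eps x n c.+1 x_gt0 nE isT _ _) _.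
  - apply: le_trans (ltW c_gt); apply: (le_trans _ (_ : 2 * x - 2 * (ln x / lam) <= _));
      last by move: (scale_ge) (eps_gt0); clear; lra.
    suff : ln x / lam <= (1 - expR (- (lam * eps / 4))) * x by clear; lra.
    by rewrite ler_pdivrMr //; move: (lngap); clear; lra.
  - have : lam * ((clique_scale lam x + eps - 1) / 2) <= lam * ((c.+1%:R - 1) / 2).
      by rewrite ler_pM2l // ler_pM2r ?invr_gt0 // lerD2r ltW.
    have -> : lam * ((clique_scale lam x + eps - 1) / 2) = lam * x - ln x + (1 - ln 2) + lam * eps / 2.
      by rewrite /clique_scale; field; rewrite gt_eqF.
    by [].
  - have le_pos : 0 < lam * eps by rewrite mulr_gt0.
    by rewrite ler_expR lerN2; move: (le_pos) (c_lo); clear; nra.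
apply: le_trans (prob_no_disjoint_cliques_le p_gt0 p_lt1 rn) _.
set a := x ^+ 2 * expR (- (lam / 2 * x)) in small1 small_le.
set b := x * expR (- (3 / 4 * lam * eps * x)) in full_le.
have a_ge0 : 0 <= a by rewrite mulr_ge0 ?expR_ge0 ?exprn_ge0 // ltW.
have b_ge0 : 0 <= b by rewrite mulr_ge0 ?expR_ge0 // ltW.
have -> : 64 * (x ^+ 3 * expR (- (lam / 2 * x))) +
   32 * expR 1 * (x ^+ 2 * expR (- (3 / 4 * lam * eps * x))) =
   4 * ((8 * a + 4 * expR 1 * b) * (2 * x)) by rewrite /a /b; ring.
rewrite ler_pM2l // /overlap_sum.
(* Each of the [r] terms is bounded by the sum of the bounds for small and for large overlaps, and
   [r <= 2 * x]. *)
apply: (@le_trans _ _ (\sum_(1 <= l < r.+1) (8 * a + 4 * expR 1 * b))); last first.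
  rewrite sumr_const_nat subSS subn0 -[leLHS]mulr_natr; apply: ler_wpM2l => //.
  by rewrite addr_ge0 // !mulr_ge0 // ltW.
have eb_ge0 : 0 <= expR 1 * b by rewrite mulr_ge0 // ltW.
rewrite !big_nat; apply: ler_sum => l /andP[l_gt0 lr]; rewrite pV.
have [l2r|rl2] := leqP (2 * l) r.
  apply: le_trans (overlap_term_small lam_gt0 n_gt0 r_gt0 r2n l_gt0 l2r _) _;
    move: (small1) (small_le) (eb_ge0) (a_ge0); clear; lra.
apply: le_trans (overlap_term_large lam_gt0 n_gt0 r_gt0 r2n _ rl2 large1) _ => //;
  move: (full_le) (eb_ge0) (a_ge0); clear; lra.
Unshelve. all: by end_near. Qed.

End ProbabilityEstimate.

(** * Motion planning in the complex *)

Section SetTypeTopology.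
Local Open Scope classical_set_scope.

Lemma cvg_set_type (T : Type) (Y : topologicalType) (C : set Y) (F : set_system T)
    (g : T -> C) (x : C) : Filter F ->
  set_val (g t) @[t --> F] --> (set_val x : Y) -> g @ F --> x.
Proof.
move=> FF gF D /= [B [[Q oO <-] Ox OD]].
have FO : F [set t | Q (set_val (g t))] := gF Q (open_nbhs_nbhs (conj oO Ox)).
change (F [set t | D (g t)]).
by apply: filterS FO => t Ot; exact: (OD _ Ot).
Qed.

End SetTypeTopology.

Section CliqueComplexTopology.
Local Open Scope classical_set_scope.
Variables (R : realType) (n : nat) (E : {set 'I_n * 'I_n}).
Local Notation X := (K_Gamma R E).

Definition coordK (v : 'I_n) (x : X) : R * R := (set_val x : {ptws 'I_n -> (R * R)%type}) v.

Lemma coordK_S1 v x : S1 (coordK v x).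
Proof. by have [H _] : K_set E (set_val x) := set_valP x; exact: H. Qed.

Lemma coordK_adj v w x : coordK v x <> S1_one R -> coordK w x <> S1_one R -> v <> w -> adj E v w.
Proof. by have [_] : K_set E (set_val x) := set_valP x; apply. Qed.

Lemma coordK_continuous v : continuous (coordK v).
Proof.
move=> x; apply: (@continuous_comp X {ptws 'I_n -> (R * R)%type} _ set_val (fun f => f v)).
  exact: initial_continuous.
exact: (@proj_continuous 'I_n (fun=> (R * R)%type) v).
Qed.

Lemma cvgK (T : Type) (F : set_system T) (g : T -> X) (x : X) : Filter F ->
  (forall v, coordK v (g t) @[t --> F] --> coordK v x) -> g @ F --> x.
Proof.
move=> FF gF.
apply: cvg_set_type; apply/cvg_sup => v A /= [B [[C oC <-] Cx CA]].
have FC : F [set t | C (coordK v (g t))].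
  exact: (gF v C (open_nbhs_nbhs (conj oC Cx))).
change (F [set t | A (set_val (g t))]).
by apply: filterS FC => t Ct; exact: (CA _ Ct).
Qed.

(** Totalised constructor: [x0] is the value when [f] is not a point of the complex. *)
Definition mkK (f : 'I_n -> R * R) (x0 : X) : X :=
  match pselect (K_set E f) with
  | left h => @SigSub _ _ _ f (mem_set h)
  | right _ => x0
  end.

Lemma coordK_mkK v f x0 : K_set E f -> coordK v (mkK f x0) = f v.
Proof. by rewrite /coordK /mkK => fK; case: pselect. Qed.

Lemma K_ext (x y : X) : (forall v, coordK v x = coordK v y) -> x = y.
Proof. by move=> xy; apply/val_inj/funext => v; exact: xy. Qed.

End CliqueComplexTopology.

Section NearFinite.
Local Open Scope classical_set_scope.

Lemma near_forall_fin (I : finType) (T : Type) (F : set_system T) (P : I -> T -> Prop) :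
  Filter F -> (forall i, \forall x \near F, P i x) -> \forall x \near F, forall i, P i x.
Proof.
move=> FF H.
have : forall s : seq I, \forall x \near F, forall i, i \in s -> P i x.
  elim=> [|i s IH]; first exact: nearW.
  have := H i; apply: filterS2 IH => x IH Pi j.
  by rewrite inE => /orP[/eqP ->|/IH].
by move=> /(_ (enum I)); apply: filterS => x Hx i; apply: Hx; rewrite mem_enum.
Qed.

End NearFinite.

(** * Contraction of the circle minus a point *)

Section CircleContraction.
Local Open Scope classical_set_scope.
Variable R : realType.
Implicit Types (b : bool) (z w : R * R) (s : R).

Definition cmul z w : R * R := (z.1 * w.1 - z.2 * w.2, z.1 * w.2 + z.2 * w.1).

(* A non-normalised square root of [z]; the branch [b = true] is continuous
   away from [1], the branch [b = false] away from [-1]. *)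
Definition circle_root b z : R * R := if b then (z.2, 1 - z.1) else (1 + z.1, z.2).

(** Planar segment from the chosen square root to [1]; [unit_square] squares and normalises it,
    which gives a motion on the circle from [z] to [1]. *)
Definition slide b z s : R * R :=
  ((1 - s) * (circle_root b z).1 + s, (1 - s) * (circle_root b z).2).

Definition unit_square (u : R * R) : R * R :=
  ((u.1 ^+ 2 - u.2 ^+ 2) / (u.1 ^+ 2 + u.2 ^+ 2),
   2 * u.1 * u.2 / (u.1 ^+ 2 + u.2 ^+ 2)).

Definition circle_contract b z s : R * R := unit_square (slide b z s).

Definition off_cut b z : Prop := if b then z.1 < 1 else -1 < z.1.

(** The root lies in the open upper half plane for [b = true] and in the open right half plane for
    [b = false], so its segment to [1] avoids the origin. *)
Lemma slide_neq0 b z s : off_cut b z -> 0 <= s <= 1 ->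
  (slide b z s).1 ^+ 2 + (slide b z s).2 ^+ 2 != 0.
Proof.
move=> bz /andP[s0 s1]; rewrite paddr_eq0 ?sqr_ge0 // !sqrf_eq0 negb_and.
rewrite /slide /circle_root; case: b bz => /= bz.
- have [->|s_neq1] := eqVneq s 1; first by rewrite subrr mul0r add0r oner_eq0.
  have s_lt1 : s < 1 by rewrite lt_neqAle s_neq1.
  by apply/orP; right; rewrite mulf_neq0 // gt_eqF // subr_gt0.
- apply/orP; left; rewrite gt_eqF //.
  have z1 : 0 < 1 + z.1 by rewrite -ltrBlDl sub0r.
  have [->|s_neq1] := eqVneq s 1; first by rewrite subrr mul0r add0r ltr01.
  have s_lt1 : s < 1 by rewrite lt_neqAle s_neq1.
  by rewrite ltr_wpDr // mulr_gt0 // subr_gt0.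
Qed.

Lemma S1_cmul z w : S1 z -> S1 w -> S1 (cmul z w).
Proof.
rewrite /S1 /cmul /= => z1 w1; rewrite -[RHS]mulr1 -{1}z1 -w1; ring.
Qed.

Lemma cmul1 z : cmul z (S1_one R) = z.
Proof. by case: z => a b; rewrite /cmul /S1_one /= !mulr1 !mulr0 subr0 add0r. Qed.

Lemma cmul1l z : cmul (S1_one R) z = z.
Proof. by case: z => a b; rewrite /cmul /S1_one /= !mul1r !mul0r subr0 addr0. Qed.

Lemma S1_contract b z s : off_cut b z -> 0 <= s <= 1 -> S1 (circle_contract b z s).
Proof.
move=> bz s01; have := slide_neq0 bz s01.
by rewrite /S1 /circle_contract; set u := slide b z s => u0 /=; field.
Qed.

Lemma contract0 b z : S1 z -> off_cut b z -> circle_contract b z 0 = z.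
Proof.
move=> z1 bz; have u0 : (slide b z 0).1 ^+ 2 + (slide b z 0).2 ^+ 2 != 0.
  by apply: slide_neq0; rewrite // lexx ler01.
have : slide b z 0 = circle_root b z.
  by rewrite /slide !subr0 !mul1r addr0 -surjective_pairing.
rewrite /circle_contract; set u := slide b z 0 in u0 * => uE.
have z2E : z.2 ^+ 2 = 1 - z.1 ^+ 2 by rewrite -z1 addrC addKr.
rewrite [RHS]surjective_pairing; congr pair; apply: (mulIf u0); rewrite mulfVK // uE /circle_root.
- by case: b {bz u0 u uE} => /=; rewrite z2E; ring.
- by case: b {bz u0 u uE} => /=; rewrite z2E; ring.
Qed.

Lemma contract1 b z : circle_contract b z 1 = S1_one R.
Proof.
by rewrite /circle_contract /unit_square /slide /= subrr !mul0r add0r expr1n expr0n /= !(subr0, addr0) mulr0 mul0r divr1.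
Qed.

(** The reason why supports do not grow: this branch keeps [1] fixed. *)
Lemma contract_one s : 0 <= s <= 1 -> circle_contract false (S1_one R) s = S1_one R.
Proof.
move=> s01; have := @slide_neq0 false (S1_one R) s; rewrite /off_cut /=.
have -> : (-1 < 1 :> R) by rewrite (lt_trans (ltrN10 R)) // ltr01.
move=> /(_ isT s01); rewrite /circle_contract /unit_square /slide /= !mulr0 expr0n /= addr0 subr0 mul0r => u0.
by rewrite divff.
Qed.

Lemma cvg_contract (T : Type) (F : set_system T) b (zf : T -> R * R) (sf : T -> R) z s :
  Filter F -> off_cut b z -> 0 <= s <= 1 -> zf t @[t --> F] --> z -> sf t @[t --> F] --> s ->
  circle_contract b (zf t) (sf t) @[t --> F] --> circle_contract b z s.
Proof.
move=> FF bz s01 cz cs; have u0 := slide_neq0 bz s01.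
have cz1 : (zf t).1 @[t --> F] --> z.1 by apply: cvg_comp cz _; exact: cvg_fst.
have cz2 : (zf t).2 @[t --> F] --> z.2 by apply: cvg_comp cz _; exact: cvg_snd.
have cB (f : T -> R) l : f t @[t --> F] --> l -> 1 - f t @[t --> F] --> 1 - l.
  by move=> fl; apply: cvgB => //; exact: cvg_cst.
have cr1 : (circle_root b (zf t)).1 @[t --> F] --> (circle_root b z).1.
  by rewrite /circle_root; case: (b) => //=; apply: cvgD => //; exact: cvg_cst.
have cr2 : (circle_root b (zf t)).2 @[t --> F] --> (circle_root b z).2.
  by rewrite /circle_root; case: (b) => //=; exact: cB.
have cu1 : (slide b (zf t) (sf t)).1 @[t --> F] --> (slide b z s).1.
  by apply: cvgD => //; apply: cvgM => //; exact: cB.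
have cu2 : (slide b (zf t) (sf t)).2 @[t --> F] --> (slide b z s).2.
  by apply: cvgM => //; exact: cB.
have cN : ((slide b (zf t) (sf t)).1 ^+ 2 + (slide b (zf t) (sf t)).2 ^+ 2)^-1 @[t --> F] -->
    ((slide b z s).1 ^+ 2 + (slide b z s).2 ^+ 2)^-1.
  by apply: cvgV => //; apply: cvgD; apply: cvgM.
apply: (@cvg_pair _ _ _ F (nbhs (circle_contract b z s).1) (nbhs (circle_contract b z s).2));
  apply: cvgM => //.
  by apply: cvgB; apply: cvgM.
by apply: cvgM => //; apply: cvgM => //; exact: cvg_cst.
Qed.

Lemma cvg_cmul (T : Type) (F : set_system T) (f g : T -> R * R) z w :
  Filter F -> f t @[t --> F] --> z -> g t @[t --> F] --> w ->
  cmul (f t) (g t) @[t --> F] --> cmul z w.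
Proof.
move=> FF cf cg.
have cf1 : (f t).1 @[t --> F] --> z.1 by apply: cvg_comp cf _; exact: cvg_fst.
have cf2 : (f t).2 @[t --> F] --> z.2 by apply: cvg_comp cf _; exact: cvg_snd.
have cg1 : (g t).1 @[t --> F] --> w.1 by apply: cvg_comp cg _; exact: cvg_fst.
have cg2 : (g t).2 @[t --> F] --> w.2 by apply: cvg_comp cg _; exact: cvg_snd.
apply: (@cvg_pair _ _ _ F (nbhs (cmul z w).1) (nbhs (cmul z w).2)).
  by apply: cvgB; apply: cvgM.
by apply: cvgD; apply: cvgM.
Qed.

End CircleContraction.

(** * The motion planner and the upper bound *)

Section MotionPlanner.
Local Open Scope classical_set_scope.
Variables (R : realType) (n : nat) (E : {set 'I_n * 'I_n}).
Local Notation X := (K_Gamma R E).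
Local Notation index := (bool * 'I_n)%type.
Implicit Types (A B : {set index}) (u : X * X) (t : R).

(** The coordinates of both points are indexed together; [true] selects the second point. *)
Definition coord2 (a : index) u : R * R := coordK a.2 (if a.1 then u.2 else u.1).

Lemma coord2_continuous a : continuous (coord2 a).
Proof.
move=> u; rewrite /coord2; case: a => -[] v /=.
  by apply: (@continuous_comp (X * X)%type X _ snd); [exact: cvg_snd|exact: coordK_continuous].
by apply: (@continuous_comp (X * X)%type X _ fst); [exact: cvg_fst|exact: coordK_continuous].
Qed.

Lemma coord2_re_continuous a : continuous (fun u => (coord2 a u).1).
Proof.
by move=> u; apply: (@continuous_comp _ (R * R)%type _ (coord2 a) fst);
  [exact: coord2_continuous|exact: cvg_fst].
Qed.

(* Charts of the same cardinality [k] are disjoint, which makes their union the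
   domain of a single motion planner. *)
Definition planner_chart A : set (X * X) := [set u |
  (forall a b, a \in A -> b \notin A -> (coord2 a u).1 < (coord2 b u).1) /\
  (forall a, off_cut (a \in A) (coord2 a u))].

Lemma near_planner_chart A u : planner_chart A u -> \forall u' \near u, planner_chart A u'.
Proof.
move=> [uA u_off].
have H1 : \forall u' \near u, forall ab : index * index,
    ab.1 \in A -> ab.2 \notin A -> (coord2 ab.1 u').1 < (coord2 ab.2 u').1.
  apply: (@near_forall_fin _ _ (nbhs u) (fun (ab : index * index) u' =>
    ab.1 \in A -> ab.2 \notin A -> (coord2 ab.1 u').1 < (coord2 ab.2 u').1)) => -[a b] /=.
  have [aA|_] := boolP (a \in A); last exact: nearW.
  have [_|bA] := boolP (b \in A); first exact: nearW.
  have : (coord2 b u').1 - (coord2 a u').1 @[u' --> u] --> (coord2 b u).1 - (coord2 a u).1.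
    by apply: cvgB; exact: coord2_re_continuous.
  have : 0 < (coord2 b u).1 - (coord2 a u).1 by rewrite subr_gt0 uA.
  move=> h /cvgr_gt /(_ _ h); apply: filterS => u' + _ _.
  by rewrite subr_gt0.
have H2 : \forall u' \near u, forall a, off_cut (a \in A) (coord2 a u').
  apply: (@near_forall_fin _ _ (nbhs u) (fun a u' => off_cut (a \in A) (coord2 a u'))) => a.
  have := u_off a; have := @coord2_re_continuous a u.
  by rewrite /off_cut; case: (a \in A) => [/cvgr_lt|/cvgr_gt]; apply.
by apply: filterS2 H1 H2 => u' h1 h2; split => // a b; exact: (h1 (a, b)).
Qed.

(** Otherwise each set has an element missing from the other, and the two charts order these
    elements in opposite ways. *)
Lemma planner_chart_inj A B u : #|A| = #|B| -> planner_chart A u -> planner_chart B u -> A = B.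
Proof.
move=> cAB [uA _] [uB _].
have [AB|/subsetPn[a aA aB]] := boolP (A \subset B).
  by apply/eqP; rewrite eqEcard AB cAB leqnn.
have [BA|/subsetPn[b bB bA]] := boolP (B \subset A).
  by apply/esym/eqP; rewrite eqEcard BA cAB leqnn.
by have := lt_trans (uA _ _ aA bA) (uB _ _ bB aB); rewrite ltxx.
Qed.

(** Clock of the first motion, which is complete at time [1 / 2]; [clamp_down] is its time
    reversal. *)
Definition clamp_up t : R := Num.min (2 * t) 1.
Definition clamp_down t : R := Num.min (2 - 2 * t) 1.

(** At each time of the motion one factor is [1], so the product on the circle concatenates the two
    motions without a case distinction. *)
Definition planner_coord A u t v : R * R :=
  cmul (circle_contract ((false, v) \in A) (coord2 (false, v) u) (clamp_up t))
       (circle_contract ((true, v) \in A) (coord2 (true, v) u) (clamp_down t)).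

Definition planner_path A u t : X := mkK (planner_coord A u t) u.1.

Lemma clamp_up01 t : 0 <= t <= 1 -> 0 <= clamp_up t <= 1.
Proof.
by move=> /andP[t0 t1]; rewrite /clamp_up le_min ge_min lexx orbT ler01 !andbT mulr_ge0.
Qed.

Lemma clamp_down01 t : 0 <= t <= 1 -> 0 <= clamp_down t <= 1.
Proof.
move=> /andP[t0 t1]; rewrite /clamp_down le_min ge_min lexx orbT ler01 !andbT.
by move: t1; clear; lra.
Qed.

Lemma clamp_continuous : continuous clamp_up /\ continuous clamp_down.
Proof.
split=> t.
- apply: (@continuous_min R R (fun t => 2 * t) (fun=> 1) t); last exact: cvg_cst.
  by apply: cvgM; [exact: cvg_cst|exact: cvg_id].
- apply: (@continuous_min R R (fun t => 2 - 2 * t) (fun=> 1) t); last exact: cvg_cst.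
  by apply: cvgB; [exact: cvg_cst|apply: cvgM; [exact: cvg_cst|exact: cvg_id]].
Qed.

(** The chart keeps the coordinates in [A] away from [1]; a coordinate equal to [1] is thus moved by
    the branch that fixes it. *)
Lemma contract_neq1 A u a s : planner_chart A u -> 0 <= s <= 1 ->
  circle_contract (a \in A) (coord2 a u) s <> S1_one R -> coord2 a u <> S1_one R.
Proof.
move=> [_ /(_ a)]; case: (a \in A) => [+ _ _|_ s01]; last first.
  by apply: contra_not => ->; exact: contract_one.
by rewrite /off_cut => + e1; rewrite e1 /= ltxx.
Qed.

Lemma planner_coordK A u t : planner_chart A u -> 0 <= t <= 1 -> K_set E (planner_coord A u t).
Proof.
move=> uA t01; have up := clamp_up01 t01; have down := clamp_down01 t01.
split=> [v|v w].
  by apply: S1_cmul; apply: S1_contract => //; exact: (uA.2).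
rewrite /planner_coord; have [th|th] := leP (2 * t) 1.
  have -> : clamp_down t = 1.
    by rewrite /clamp_down min_r //; move: th; clear; lra.
  rewrite !contract1 !cmul1 => /(contract_neq1 uA up) v1 /(contract_neq1 uA up) w1.
  exact: (coordK_adj v1 w1).
have -> : clamp_up t = 1 by rewrite /clamp_up min_r // ltW.
rewrite !contract1 !cmul1l => /(contract_neq1 uA down) v1 /(contract_neq1 uA down) w1.
exact: (coordK_adj v1 w1).
Qed.

Lemma planner_path0 A u : planner_chart A u -> planner_path A u 0 = u.1.
Proof.
move=> uA; apply: K_ext => v; rewrite coordK_mkK; last first.
  by apply: planner_coordK; rewrite // lexx ler01.
rewrite /planner_coord /clamp_up /clamp_down mulr0 subr0 min_l ?ler01 // min_r ?ler1n //.
rewrite contract1 cmul1 contract0 //; last exact: uA.2.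
exact: coordK_S1.
Qed.

Lemma planner_path1 A u : planner_chart A u -> planner_path A u 1 = u.2.
Proof.
move=> uA; apply: K_ext => v; rewrite coordK_mkK; last first.
  by apply: planner_coordK; rewrite // lexx ler01.
rewrite /planner_coord /clamp_up /clamp_down mulr1 subrr min_r ?ler1n // min_l ?ler01 //.
rewrite contract1 cmul1l contract0 //; last exact: uA.2.
exact: coordK_S1.
Qed.

Local Notation I01 := (unit_interval R).

Lemma unit_interval01 (t : I01) : 0 <= set_val t <= 1.
Proof. by have : `[0, 1]%classic (set_val t) := set_valP t; rewrite /= in_itv. Qed.

Lemma planner_path_cvg A u (t : I01) : planner_chart A u ->
  planner_path A z.2 (set_val z.1) @[z --> (t, u)] --> planner_path A u (set_val t).
Proof.
move=> uA; apply: cvgK => v.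
have c1 : set_val z.1 @[z --> (t, u)] --> set_val t.
  by apply: (@cvg_comp _ _ _ fst (@set_val _ _) _ (nbhs t)); [exact: cvg_fst|exact: initial_continuous].
have c2 a : coord2 a z.2 @[z --> (t, u)] --> coord2 a u.
  by apply: (@cvg_comp _ _ _ snd (coord2 a) _ (nbhs u)); [exact: cvg_snd|exact: coord2_continuous].
have t01 := unit_interval01 t.
have [cup cdown] := clamp_continuous.
rewrite coordK_mkK; last exact: planner_coordK.
have h : planner_coord A z.2 (set_val z.1) v @[z --> (t, u)] --> planner_coord A u (set_val t) v.
  apply: cvg_cmul; apply: cvg_contract.
  - exact: uA.2.
  - exact: clamp_up01.
  - exact: c2.
  - by apply: (@cvg_comp _ _ _ (fun z : I01 * (X * X) => set_val z.1) clamp_up _ (nbhs (set_val t))) => //; exact: cup.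
  - exact: uA.2.
  - exact: clamp_down01.
  - exact: c2.
  - by apply: (@cvg_comp _ _ _ (fun z : I01 * (X * X) => set_val z.1) clamp_down _ (nbhs (set_val t))) => //; exact: cdown.
apply: cvg_trans h; apply: near_eq_cvg.
exists (setT, planner_chart A) => /=; first by split; [exact: filterT|exact: near_planner_chart].
move=> [t' u'] /= [_ u'A]; rewrite coordK_mkK //.
by apply: planner_coordK => //; exact: unit_interval01.
Qed.

(** By [planner_chart_inj] the choice is unique on the [k]-th open set, hence locally constant
    there, and the planners of the charts of size [k] glue. *)
Definition chart_of (k : nat) u : {set index} :=
  xget boot.finset.set0 [set A : {set index} | #|A| = k /\ planner_chart A u].

Lemma chart_ofE k A u : #|A| = k -> planner_chart A u -> chart_of k u = A.
Proof.
move=> Ak uA; rewrite /chart_of; case: xgetP => [B _ [Bk uB]|/(_ A)]; last by case.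
by apply: planner_chart_inj uB uA; rewrite Ak.
Qed.

Lemma planner_section k :
  @path_section R X [set u | exists A : {set index}, #|A| = k /\ planner_chart A u]
    (fun u (t : I01) => planner_path (chart_of k u) u (set_val t)).
Proof.
have openU : open [set u | exists A : {set index}, #|A| = k /\ planner_chart A u].
  rewrite openE => u [A [Ak uA]]; apply: filterS (near_planner_chart uA) => u' u'A.
  by exists A.
split.
- rewrite continuous_open_subspace // => u; rewrite inE => -[A [Ak uA]].
  (* Compactness of [K] turns joint continuity in time and endpoints into one neighbourhood of [u]
     that serves all times in [K]. *)
  apply/compact_open_cvgP => K O cptK oO uKO /=.
  near=> z => _ [t Kt <-].
  have -> : chart_of k z = A.
    by apply: chart_ofE => //; near: z; exact: near_planner_chart.
  move: t Kt; near: z.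
  move/compact_near_coveringP/near_covering_withinP : cptK; apply => t Kt.
  have Out : O (planner_path A u (set_val t)).
    by rewrite -(chart_ofE Ak uA); apply: uKO; exists t.
  have H := @planner_path_cvg A u t uA O (open_nbhs_nbhs (conj oO Out)).
  case: H => -[P Q] [Pt Qu] PQ; exists (P, Q) => // -[t' u'] [Pt' Qu'] _.
  exact: (PQ (t', u')).
- move=> u [A [Ak uA]] t; rewrite (chart_ofE Ak uA).
  apply: (@cvg_comp _ _ _ (fun t : I01 => (t, u)) (fun z => planner_path A z.2 (set_val z.1)) _ (nbhs (t, u))).
    by apply: (@cvg_pair _ _ _ (nbhs t) (nbhs t) (nbhs u)); [exact: cvg_id|exact: cvg_cst].
  exact: planner_path_cvg.
- by move=> u t [A [Ak uA]] ->; rewrite (chart_ofE Ak uA) planner_path0.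
- by move=> u t [A [Ak uA]] ->; rewrite (chart_ofE Ak uA) planner_path1.
Unshelve. all: by end_near. Qed.

Lemma tc_cover_clique_complex (c : nat) :
  (forall S : {set 'I_n}, clique E S -> (#|S| <= c)%N) -> @tc_cover R X (2 * c + 1).
Proof.
move=> cE; exists (fun k => [set u | exists A : {set index}, #|A| = k /\ planner_chart A u]); split; last split.
- move=> k; rewrite openE => u [A [Ak uA]]; apply: filterS (near_planner_chart uA) => u' u'A.
  by exists A.
- apply/seteqP; split => // u _.
  (* A pair lies in the chart of its nontrivial coordinates: these have real part below [1], the
     others equal [1]. Both supports are cliques, so the sizes [0] to [2 * c] suffice. *)
  pose A := [set a : index | coord2 a u != S1_one R]%SET.
  have Ac : (#|A| <= 2 * c)%N.
    pose S b := [set v : 'I_n | coord2 (b, v) u != S1_one R]%SET.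
    have Sc b : (#|S b| <= c)%N.
      apply/cE/cliqueP => v w; rewrite !inE => /eqP vS /eqP wS /eqP vw.
      exact: coordK_adj vS wS vw.
    have -> : #|A| = (#|S false| + #|S true|)%N.
      rewrite -!sum1_card [LHS]big_mkcond /=.
      rewrite (eq_bigr (fun a => if (a.1, a.2) \in A then 1 else 0)%N); last by case.
      rewrite -(pair_bigA _ (fun b v => if (b, v) \in A then 1 else 0)%N) /= big_bool addnC.
      by congr (_ + _)%N; rewrite [RHS]big_mkcond; apply: eq_bigr => v _; rewrite !inE.
    by rewrite mul2n -addnn leq_add.
  have Aord : (#|A| < 2 * c + 1)%N by rewrite addn1 ltnS.
  exists (Ordinal Aord) => //; exists A; split => //.
  have re_lt1 a : coord2 a u != S1_one R -> (coord2 a u).1 < 1.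
    move=> a1; have : S1 (coord2 a u) by exact: coordK_S1.
    case: (coord2 a u) a1 => x y /= xy1; rewrite /S1 /= => S1xy.
    rewrite ltNge; apply/negP => x1; case/eqP: xy1; rewrite /S1_one.
    have y0 : y ^+ 2 <= 0.
      by move: S1xy x1; clear; nra.
    have y0' : y = 0 by apply/eqP; rewrite -sqrf_eq0 eq_le y0 sqr_ge0.
    by move: S1xy x1; rewrite y0' => h1 h2; congr pair; move: h1 h2; clear; nra.
  split=> [a b|a].
    by rewrite !inE negbK => a1 /eqP ->; exact: re_lt1.
  rewrite inE /off_cut; case: eqP => [->|/eqP a1] /=; last exact: re_lt1.
  by rewrite (lt_trans (ltrN10 R)) // ltr01.
- by move=> k; exists (fun u (t : I01) => planner_path (chart_of k u) u (set_val t)); exact: planner_section.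
Qed.

End MotionPlanner.

(** * Coverings of a torus *)

Section AngleIncrements.
Variable R : realType.
Implicit Types (z w : R * R) (b : R).

Definition dot z w : R := z.1 * w.1 + z.2 * w.2.
Definition rotate b z : R * R := (z.1 * cos b - z.2 * sin b, z.1 * sin b + z.2 * cos b).
(** On the unit circle the cross product is the sine of the oriented angle, so this is the angle
    from [z] to [w] as long as it is at most [pi / 2] in absolute value. *)
Definition angle_incr z w : R := asin (z.1 * w.2 - z.2 * w.1).

Definition close_angle z w : Prop := cos (pi / 4) < dot z w.

Lemma close_angle_rotate z w : S1 z -> S1 w -> close_angle z w ->
  exists2 b, `|b| < pi / 4 & w = rotate b z.
Proof.
rewrite /S1 /close_angle /= => z1 w1 zw.
have pi_gt0 := pi_gt0 R.
set c := z.1 * w.2 - z.2 * w.1.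
have cd : c ^+ 2 + dot z w ^+ 2 = 1.
  by rewrite -[RHS]mulr1 -{1}z1 -w1 /c /dot; ring.
have c_le : -1 <= c <= 1.
  by have := sqr_ge0 (dot z w); move: cd; clear; nra.
have cos4_gt0 : 0 < cos (pi / 4 : R) by apply: cos_gt0_pihalf; apply/andP; split; lra.
have d_gt0 : 0 < dot z w by apply: lt_trans zw.
have cosb : cos (asin c) = dot z w.
  rewrite cos_asin // -cd addrC addKr sqrtr_sqr gtr0_norm //.
have sinb : sin (asin c) = c by apply: asinK; rewrite in_itv.
exists (asin c); last first.
  rewrite /rotate sinb cosb [LHS]surjective_pairing /c /dot; congr pair.
    by rewrite -[LHS]mul1r -z1; ring.
  by rewrite -[LHS]mul1r -z1; ring.
have : cos (pi / 4) < cos `|asin c| by rewrite cos_norm cosb.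
rewrite ltr_cos //; rewrite in_itv /=; last by apply/andP; split; move: pi_gt0; clear; lra.
have b_le : `|asin c| <= pi / 2.
  by rewrite ler_norml asin_geNpi2 ?asin_lepi2.
by rewrite normr_ge0 /=; move: b_le pi_gt0; clear; lra.
Qed.

Lemma asin_sin_small b : `|b| <= pi / 2 -> asin (sin b) = b.
Proof. by move=> b_le; rewrite sinK // in_itv /= -ler_norml. Qed.

Lemma angle_incr_rotate b c z : S1 z -> `|b| < pi / 4 -> `|c| < pi / 4 ->
  angle_incr (rotate b z) (rotate c z) = c - b.
Proof.
rewrite /S1 /= => z1 b4 c4; have pi_gt0 := pi_gt0 R.
rewrite /angle_incr -[RHS]asin_sin_small.
  congr asin; rewrite sinB -[RHS]mul1r -z1 /rotate /=; ring.
by apply: (le_trans (ler_normB c b)); move: b4 c4 pi_gt0; clear; lra.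
Qed.

Lemma rotate0 z : rotate 0 z = z.
Proof. by case: z => x y; rewrite /rotate /= cos0 sin0 !mulr1 !mulr0 subr0 add0r. Qed.

(** All four points lie within [pi / 4] of [z], on an arc where increments are differences of a
    single angle function. *)
Lemma angle_incr_exchange z w z' w' : S1 z -> S1 w -> S1 z' -> S1 w' ->
  close_angle z w -> close_angle z z' -> close_angle z w' ->
  angle_incr z' w' - angle_incr z w = angle_incr w w' - angle_incr z z'.
Proof.
move=> z1 w1 z1' w1' /(close_angle_rotate z1 w1)[b b4 ->].
move=> /(close_angle_rotate z1 z1')[c c4 ->] /(close_angle_rotate z1 w1')[d d4 ->].
have o4 : `|0 : R| < pi / 4 by rewrite normr0 divr_gt0 // pi_gt0.
have from_z a : `|a| < pi / 4 -> angle_incr z (rotate a z) = a.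
  by move=> a4; rewrite -{1}(rotate0 z) angle_incr_rotate // subr0.
rewrite !angle_incr_rotate // !from_z //; ring.
Qed.

Definition circle_pt (x : R) : R * R := (cos (2 * pi * x), sin (2 * pi * x)).

Lemma S1_circle_pt x : S1 (circle_pt x).
Proof. by rewrite /S1 /circle_pt /= cos2Dsin2. Qed.

Lemma circle_pt_natD x (k : nat) : circle_pt (x + k%:R) = circle_pt x.
Proof.
elim: k => [|k IH]; first by rewrite addr0.
rewrite -IH -natr1 addrA /circle_pt mulrDr mulr1 mulr_natl.
by rewrite sinD2pi cosD2pi.
Qed.

Lemma angle_incr_circle_pt x d : `|2 * pi * d| <= pi / 2 ->
  angle_incr (circle_pt x) (circle_pt (x + d)) = 2 * pi * d.
Proof.
move=> d_le; rewrite /angle_incr -[RHS]asin_sin_small // /circle_pt /=.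
congr asin; have -> : 2 * pi * d = 2 * pi * (x + d) - 2 * pi * x by ring.
by rewrite sinB; ring.
Qed.

Lemma angle_incr_id z : angle_incr z z = 0.
Proof.
rewrite /angle_incr (_ : _ - _ = sin 0); last by rewrite sin0 mulrC subrr.
by rewrite asin_sin_small // normr0 divr_ge0 // pi_ge0.
Qed.

(** Discrete homotopy: the windings of two nearby paths differ only by the motion of the endpoints;
    the rest telescopes. *)
Lemma angle_sum_exchange (N : nat) (f g : nat -> R * R) :
  (forall m, S1 (f m)) -> (forall m, S1 (g m)) ->
  (forall m, (m < N)%N ->
     [/\ close_angle (f m) (f m.+1), close_angle (f m) (g m) & close_angle (f m) (g m.+1)]) ->
  \sum_(0 <= m < N) angle_incr (g m) (g m.+1) - \sum_(0 <= m < N) angle_incr (f m) (f m.+1)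
  = angle_incr (f N) (g N) - angle_incr (f 0) (g 0).
Proof.
move=> f1 g1 fg; rewrite -sumrB -(telescope_sumr (fun m => angle_incr (f m) (g m)) (leq0n N)).
by apply: eq_big_nat => m /andP[_ /fg[? ? ?]]; rewrite angle_incr_exchange.
Qed.

End AngleIncrements.

(** * Tori of cliques and local behaviour of sections *)

Section TorusObstruction.
Local Open Scope classical_set_scope.
Variables (R : realType) (n : nat) (E : {set 'I_n * 'I_n}).
Local Notation X := (K_Gamma R E).
Local Notation I01 := (unit_interval R).
Implicit Types (S : {set 'I_n}) (y : 'rV[R]_n) (t : R).

(** Retraction onto the interval, by which paths become functions of a real time. *)
Definition clamp01 t : R := Num.min (Num.max t 0) 1.

Lemma clamp01_in t : `[0, 1]%classic (clamp01 t).
Proof. by rewrite /= in_itv /= /clamp01 le_min le_max ge_min !lexx ler01 !orbT. Qed.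

Definition to_I01 t : I01 := SigSub (mem_set (clamp01_in t)).

Lemma to_I01K t : 0 <= t <= 1 -> set_val (to_I01 t) = t.
Proof.
by move=> /andP[t0 t1]; rewrite /to_I01 set_valE /= /clamp01 max_l // min_l.
Qed.

Lemma to_I01_continuous : continuous to_I01.
Proof.
move=> t; apply: cvg_set_type.
have cmax : {for t, continuous (fun t : R => Num.max t 0)}.
  by apply: (@continuous_max R R (fun t => t) (fun=> 0) t); [exact: cvg_id|exact: cvg_cst].
by apply: (@continuous_min R R (fun t => Num.max t 0) (fun=> 1) t); [exact: cmax|exact: cvg_cst].
Qed.

Lemma K_base : K_set E (fun=> S1_one R).
Proof. by split=> [v|v w]; rewrite /S1 /S1_one //= expr1n expr0n addr0. Qed.

Definition base_pt : X := SigSub (mem_set K_base).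

Definition torus_coord S y v : R * R := if v \in S then circle_pt (y ord0 v) else S1_one R.

Lemma torus_coordK S y : clique E S -> K_set E (torus_coord S y).
Proof.
move=> /cliqueP cS; split=> [v|v w]; rewrite /torus_coord.
  by case: ifP => _; [exact: S1_circle_pt|rewrite /S1 /S1_one /= expr1n expr0n addr0].
by case: ifP => // vS _; case: ifP => // wS _ /eqP; exact: cS.
Qed.

Definition torus_pt S y : X := mkK (torus_coord S y) base_pt.

Lemma coordK_torus_pt S y v : clique E S -> coordK v (torus_pt S y) = torus_coord S y v.
Proof. by move=> cS; rewrite /torus_pt coordK_mkK //; exact: torus_coordK. Qed.

Lemma circle_pt_continuous : continuous (@circle_pt R).
Proof.
move=> x; have cm : 2 * pi * x @[x --> x] --> 2 * pi * x.
  by apply: cvgM; [exact: cvg_cst|exact: cvg_id].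
apply: (@cvg_pair _ _ _ (nbhs x) (nbhs (cos (2 * pi * x))) (nbhs (sin (2 * pi * x)))).
  by apply: cvg_comp cm _; exact: continuous_cos.
by apply: cvg_comp cm _; exact: continuous_sin.
Qed.

Lemma torus_pt_continuous S : clique E S -> continuous (torus_pt S).
Proof.
move=> cS y; apply: (@cvgK _ _ _ _ (nbhs y)) => v; rewrite coordK_torus_pt //.
under eq_fun do rewrite coordK_torus_pt //.
rewrite /torus_coord; case: ifP => _; last exact: (@cvg_cst _ (S1_one R) _ (nbhs y) _).
apply: (@continuous_comp _ _ _ (fun y : 'rV[R]_n => y ord0 v) (@circle_pt R)).
  exact: coord_continuous.
exact: circle_pt_continuous.
Qed.

(** Joint continuity of evaluation: a compact interval of times around [t0] defines a compact-open
    neighbourhood of the path. *)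
Lemma section_near (U : set (X * X)) (s : X * X -> {compact-open, I01 -> X})
    (u0 : X * X) t0 (W : set X) :
  open U -> path_section U s -> U u0 -> nbhs (s u0 (to_I01 t0)) W ->
  \forall z \near (t0, u0), W (s z.2 (to_I01 z.1)).
Proof.
move=> oU [s_cont path_cont _ _] Uu0; rewrite nbhsE => -[Q [oO Ox OW]].
have cont_t : {for t0, continuous (fun t => s u0 (to_I01 t))}.
  apply: (@continuous_comp R I01 X to_I01 (s u0)); first exact: to_I01_continuous.
  exact: path_cont.
have /nbhs_ballP[e /= e_gt0 eO] := cont_t _ (open_nbhs_nbhs (conj oO Ox)).
pose K := to_I01 @` `[t0 - e / 2, t0 + e / 2].
have cptK : compact K.
  apply: continuous_compact; last exact: segment_compact.
  exact/continuous_subspaceT/to_I01_continuous.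
have KO : s u0 @` K `<=` Q.
  move=> _ [_ [t tK <-] <-]; apply: eO; rewrite /ball /=.
  move: tK; rewrite /= in_itv /= => /andP[lo hi].
  rewrite ltr_norml; apply/andP; split; move: lo hi e_gt0; clear; lra.
rewrite continuous_open_subspace // in s_cont.
have s_u0 := s_cont u0 (mem_set Uu0).
have /compact_open_cvgP/(_ K Q cptK oO KO) nearK := s_u0.
exists (ball t0 (e / 2), [set u | s u @` K `<=` Q]) => /=.
  by split; [apply: nbhsx_ballx; rewrite divr_gt0|exact: nearK].
move=> [t u] /= [t_near uK]; apply/OW/uK; exists (to_I01 t) => //; exists t => //.
move: t_near; rewrite /ball /= in_itv /= ltr_norml => /andP[lo hi].
by apply/andP; split; move: lo hi; clear; lra.
Qed.

Lemma close_angle_near (x : X) :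
  exists2 W, nbhs x W & forall x1 x2, W x1 -> W x2 -> forall v, close_angle (coordK v x1) (coordK v x2).
Proof.
have H : \forall z \near (x, x), forall v, close_angle (coordK v z.1) (coordK v z.2).
  apply: (@near_forall_fin _ _ (nbhs (x, x)) (fun v z => close_angle (coordK v z.1) (coordK v z.2))) => v.
  have c1 : coordK v z.1 @[z --> (x, x)] --> coordK v x.
    by apply: (@cvg_comp _ _ _ fst (coordK v) _ (nbhs x)); [exact: cvg_fst|exact: coordK_continuous].
  have c2 : coordK v z.2 @[z --> (x, x)] --> coordK v x.
    by apply: (@cvg_comp _ _ _ snd (coordK v) _ (nbhs x)); [exact: cvg_snd|exact: coordK_continuous].
  have cd : dot (coordK v z.1) (coordK v z.2) @[z --> (x, x)] --> dot (coordK v x) (coordK v x).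
    rewrite /dot; apply: cvgD; apply: cvgM.
    - by apply: cvg_comp c1 _; exact: cvg_fst.
    - by apply: cvg_comp c2 _; exact: cvg_fst.
    - by apply: cvg_comp c1 _; exact: cvg_snd.
    - by apply: cvg_comp c2 _; exact: cvg_snd.
  move/cvgr_gt: cd; apply.
  have -> : dot (coordK v x) (coordK v x) = 1 by rewrite -(coordK_S1 v x) /dot !expr2.
  have pi_gt0 := pi_gt0 R.
  by rewrite -[ltRHS]cos0 ltr_cos ?divr_gt0 //; rewrite in_itv /=;
    apply/andP; split; lra.
case: H => -[P Q] [Px Qx] PQ; exists (P `&` Q); first exact: filterI.
by move=> x1 x2 [P1 _] [_ Q2]; exact: (PQ (x1, x2)).
Qed.

End TorusObstruction.

(** * Winding of planned paths and the lower bound *)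

Section TorusLowerBound.
Local Open Scope classical_set_scope.
Variables (R : realType) (n : nat) (E : {set 'I_n * 'I_n}).
Local Notation X := (K_Gamma R E).
Local Notation I01 := (unit_interval R).
Variables A B : {set 'I_n}.
Hypotheses (cliqueA : clique E A) (cliqueB : clique E B) (disAB : forall v, v \in A -> v \notin B).
Implicit Types (y : 'rV[R]_n) (t : R) (s : X * X -> {compact-open, I01 -> X}).

(** As [A] and [B] are disjoint, one vector parametrises the product of both tori: each coordinate
    moves at most one of the two points. *)
Definition torus2 y : X * X := (torus_pt E A y, torus_pt E B y).

Lemma torus2_continuous : continuous torus2.
Proof.
move=> y; apply: (@cvg_pair _ _ _ (nbhs y) (nbhs (torus_pt E A y)) (nbhs (torus_pt E B y))).
  exact: torus_pt_continuous.
exact: torus_pt_continuous.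
Qed.

Definition trace s y v t : R * R := coordK v (s (torus2 y) (to_I01 t)).

Definition uniform_on (U : set (X * X)) s (D : set 'rV[R]_n) (d : R) : Prop :=
  forall y y', D y -> D y' -> U (torus2 y) /\
    forall v t t', 0 <= t <= 1 -> `|t - t'| < d -> close_angle (trace s y v t) (trace s y' v t').

Lemma near_infty_lt (K e : R) : 0 < e -> \forall N \near \oo, K / N.+1%:R < e.
Proof.
move=> e_gt0; near=> N; rewrite ltr_pdivrMr ?ltr0n // -ltr_pdivrMl //.
apply: (@lt_trans _ _ N%:R); last by rewrite ltr_nat.
by near: N; exact: nbhs_infty_gtr.
Unshelve. all: by end_near. Qed.

(** Closeness near each [(t, y0)] is made uniform in [t] by compactness of [[0, 1]]. *)
Lemma local_uniform (U : set (X * X)) s y0 : open U -> path_section U s -> U (torus2 y0) ->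
  exists2 e, 0 < e & uniform_on U s (ball y0 e) e.
Proof.
move=> oU sU Uy0.
have UN : \forall y \near y0, U (torus2 y).
  by apply: torus2_continuous; exact: open_nbhs_nbhs.
have /nbhs_ballP[e0 /= e0_gt0 e0U] := UN.
have seg : near_covering (`[0, 1] : set R).
  by apply/compact_near_coveringP; exact: segment_compact.
pose P (N : nat) t := forall y y' v t', ball y0 (1 / N.+1%:R) y -> ball y0 (1 / N.+1%:R) y' ->
  `|t - t'| < 1 / N.+1%:R -> close_angle (trace s y v t) (trace s y' v t').
have : \forall N \near \oo, `[0, 1] `<=` P N.
  apply: seg => t0 t0_in.
  have [W Wx Wclose] := close_angle_near (s (torus2 y0) (to_I01 t0)).
  have [[P1 P2] /= [P1t P2u] P12] := section_near oU sU Uy0 Wx.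
  have P2y : \forall y \near y0, P2 (torus2 y) by exact: torus2_continuous.
  have /nbhs_ballP[e1 /= e1_gt0 e1P] := P1t.
  have /nbhs_ballP[e2 /= e2_gt0 e2P] := P2y.
  exists (ball t0 (e1 / 2), [set N | 1 / N.+1%:R < e1 / 2 /\ 1 / N.+1%:R < e2]) => /=.
    split; first by apply: nbhsx_ballx; rewrite divr_gt0.
    by apply: filterI; apply: near_infty_lt; rewrite ?divr_gt0.
  move=> [t N] /= [t_near [N1 N2]] y y' v t' yN y'N tt'.
  have t'_near : ball t0 e1 t'.
    rewrite /ball /=; have -> : t0 - t' = (t0 - t) + (t - t') by ring.
    apply: (le_lt_trans (ler_normD _ _)); rewrite [ltRHS]splitr; apply: ltrD => //.
    exact: lt_trans N1.
  have t_near' : ball t0 e1 t.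
    by apply: le_ball t_near; rewrite ler_pdivrMr // mulr_natr mulr2n lerDl ltW.
  apply: Wclose; apply: (P12 (_, torus2 _)); split => /=.
  - exact: e1P.
  - by apply: e2P; apply: le_ball yN; exact: ltW.
  - exact: e1P.
  - by apply: e2P; apply: le_ball y'N; exact: ltW.
move=> nearP.
have /filter_ex[N [PN eN]] : \forall N \near \oo, `[0, 1] `<=` P N /\ 1 / N.+1%:R < e0.
  by apply: filterI => //; exact: near_infty_lt.
exists (1 / N.+1%:R); first by rewrite divr_gt0 // ltr0n.
move=> y y' yN y'N; split; first by apply: e0U; apply: le_ball yN; exact: ltW.
by move=> v t t' t01 tt'; apply: PN => //; rewrite /= in_itv.
Qed.

Lemma uniform_onS (U : set (X * X)) s (D D' : set 'rV[R]_n) (d d' : R) :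
  D' `<=` D -> d' <= d -> uniform_on U s D d -> uniform_on U s D' d'.
Proof.
move=> DD dd H y y' /DD Dy /DD Dy'; have [Uy Hy] := H y y' Dy Dy'; split => //.
by move=> v t t' t01 tt'; apply: Hy => //; apply: lt_le_trans dd.
Qed.

(** Lebesgue number argument on the cube: one mesh serves all points, while the open set depends on
    the point. The bound [3 < N] keeps a grid step within a quarter turn. *)
Lemma global_uniform (k : nat) (U : 'I_k -> set (X * X)) (s : 'I_k -> X * X -> {compact-open, I01 -> X}) :
  (forall i, open (U i)) -> \bigcup_i U i = [set: X * X] -> (forall i, path_section (U i) (s i)) ->
  exists2 N : nat, (3 < N)%N & forall y, (forall v, 0 <= y ord0 v <= 1) ->
    exists i, uniform_on (U i) (s i) (ball y (2 / N%:R)) (2 / N%:R).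
Proof.
move=> oU covU sU.
pose cube := [set y : 'rV[R]_n | forall v, `[0, 1]%classic (y ord0 v)].
have cptC : near_covering cube.
  apply/compact_near_coveringP.
  by apply: (@rV_compact R n (fun=> `[0, 1]%classic)) => v; exact: segment_compact.
pose good (N : nat) y := exists i, uniform_on (U i) (s i) (ball y (2 / N.+1%:R)) (2 / N.+1%:R).
have nearG : \forall N \near \oo, cube `<=` good N.
  apply: cptC => y0 _.
  have [i _ Ui] : (\bigcup_i U i) (torus2 y0) by rewrite covU.
  have [e e_gt0 He] := local_uniform (oU i) (sU i) Ui.
  exists (ball y0 (e / 2), [set N | 2 / N.+1%:R < e / 2]) => /=.
    split; first by apply: nbhsx_ballx; rewrite divr_gt0.
    by apply: near_infty_lt; rewrite divr_gt0.
  move=> [y N] /= [y_near N2]; exists i; apply: uniform_onS He.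
    move=> y' y'y; apply: (@le_ball _ _ _ (e / 2 + 2 / N.+1%:R)).
      by rewrite [leRHS](splitr e) lerD2l ltW.
    exact: ball_triangle y'y.
  by apply: (le_trans (ltW N2)); rewrite ler_pdivrMr // mulr_natr mulr2n lerDl ltW.
have /filter_ex[N [HN N3]] : \forall N \near \oo, cube `<=` good N /\ (3 < N)%N.
  by apply: filterI => //; exact: nbhs_infty_gt.
exists N.+1; first exact: ltnW.
by move=> y y01; apply: HN => v /=; rewrite in_itv /= y01.
Qed.

(** * The grid on the torus *)

Section Grid.
Variable M : nat.
Local Notation N := M.+1.
Local Notation grid := 'rV['I_N]_n.
Implicit Types (x : grid) (C : {set 'I_n}).

Definition grid_step (a : 'I_n) : grid := \row_j inZp (a == j).

Lemma sum_grid_step C j : (\sum_(b in C) grid_step b) ord0 j = inZp (j \in C).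
Proof.
rewrite summxE; under eq_bigr do rewrite mxE.
have [jC|jC] := boolP (j \in C).
  rewrite (bigD1 j) //= eqxx big1 ?addr0 // => b /andP[_ /negPf ->].
  exact/val_inj.
rewrite big1 => [|b bC]; first exact/val_inj.
have /negPf -> : b != j by apply: contraNneq jC => <-.
exact/val_inj.
Qed.

(** Not reduced modulo [N], so that the vertices of a cell stay close to each other across the seam;
    by [torus2_cell] the torus point is that of the reduced vertex. *)
Definition cell_vertex x C : 'rV[R]_n := \row_j (((x ord0 j : nat) + (j \in C))%:R / N%:R).

Lemma circle_pt_mod (k : nat) : circle_pt ((k %% N)%:R / N%:R) = circle_pt (k%:R / N%:R) :> R * R.
Proof.
rewrite [in RHS](divn_eq k N) natrD natrM mulrDl mulfK ?pnatr_eq0 // addrC.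
by rewrite circle_pt_natD.
Qed.

Lemma torus2_cell x C :
  torus2 (cell_vertex (x + \sum_(b in C) grid_step b) boot.finset.set0) = torus2 (cell_vertex x C).
Proof.
have H v : circle_pt (cell_vertex (x + \sum_(b in C) grid_step b) boot.finset.set0 ord0 v) =
    circle_pt (cell_vertex x C ord0 v).
  rewrite !mxE boot.finset.in_set0 addn0 -[RHS]circle_pt_mod sum_grid_step /=.
  by rewrite modnDmr.
by congr pair; apply: K_ext => v; rewrite !coordK_torus_pt // /torus_coord; case: ifP.
Qed.

Lemma cell_vertex_ball x C : ball (cell_vertex x boot.finset.set0) (2 / N%:R) (cell_vertex x C).
Proof.
have N_gt0 : 0 < N%:R :> R by rewrite ltr0n.
split; first by rewrite divr_gt0.
move=> i j; rewrite /ball /= !mxE boot.finset.in_set0 addn0 -mulrBl normrM [`|_^-1|]gtr0_norm ?invr_gt0 //.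
rewrite ltr_pM2r ?invr_gt0 // natrD opprD addrA subrr sub0r normrN.
by case: (j \in C); rewrite ?normr1 ?normr0 // ltr1n.
Qed.

Lemma cell_vertex_step x C a v : (2 < M)%N -> a \notin C ->
  angle_incr (circle_pt (cell_vertex x C ord0 v)) (circle_pt (cell_vertex x (a |: C) ord0 v)) =
  (a == v)%:R * (2 * pi / N%:R).
Proof.
move=> M2 aC; rewrite !mxE boot.finset.in_setU1 eq_sym.
have [<-|_] := eqVneq a v; last by rewrite mul0r orFb angle_incr_id.
rewrite (negPf aC) addn0 /= natrD mulrDl angle_incr_circle_pt ?mul1r //.
have pi_gt0 := pi_gt0 R.
rewrite gtr0_norm ?mulr_gt0 ?invr_gt0 ?ltr0n // ler_pdivrMr ?ltr0n //.
have : (4 <= N%:R :> R) by rewrite ler_nat.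
by nra.
Qed.

End Grid.

Lemma tc_cover_lower_bound (k : nat) : @tc_cover R X k -> (#|A| + #|B| < k)%N.
Proof.
move=> [U [oU [covU /choice[s sU]]]]; rewrite ltnNge; apply/negP => k_le.
have [[//|M] M2 HM] := global_uniform oU covU sU.
have sec0 i u : U i u -> s i u (to_I01 0) = u.1.
  by move=> Uu; have [_ _ + _] := sU i; apply => //; rewrite to_I01K // lexx ler01.
have sec1 i u : U i u -> s i u (to_I01 1) = u.2.
  by move=> Uu; have [_ _ _ +] := sU i; apply => //; rewrite to_I01K // lexx ler01.
(* The [i]-th open set is attributed to the [i]-th coordinate of this list. *)
pose sq := enum A ++ enum B.
have sq_uniq : uniq sq.
  rewrite cat_uniq !enum_uniq andbT /=; apply/hasPn => v; rewrite !mem_enum.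
  by move=> vB; apply/negP => /disAB; rewrite vB.
have sq_size : size sq = (#|A| + #|B|)%N by rewrite size_cat -!cardE.
pose W (i : 'I_k) (v : 'I_n) y : R := \sum_(0 <= m < M.+1)
  angle_incr (trace (s i) y v (m%:R / M.+1%:R)) (trace (s i) y v (m.+1%:R / M.+1%:R)).
(* For [v] in [A] the starting point moves and the winding drops by the grid step; for [v] in [B]
   the end point moves and the winding rises. The sign makes [h] cancel the angular cochain in both
   cases. *)
pose sgn (v : 'I_n) : R := if v \in A then 1 else -1.
(* The default [0] applies to positions beyond the number [k] of open sets. *)
pose h (v : 'I_n) (x : 'rV['I_M.+1]_n) : R :=
  oapp (fun i : 'I_k => sgn v * W i v (cell_vertex x boot.finset.set0)) 0 (insub (index v sq)).
have N_gt0 : 0 < M.+1%:R :> R by rewrite ltr0n.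
have t_neq0 : 2 * pi / M.+1%:R != 0 :> R.
  by rewrite gt_eqF // divr_gt0 // mulr_gt0 // pi_gt0.
apply: (@cochain_obstruction R _ n (@grid_step M) _ h sq sq_uniq t_neq0) => x.
have [i Hi] : exists i, uniform_on (U i) (s i)
    (ball (cell_vertex x boot.finset.set0) (2 / M.+1%:R)) (2 / M.+1%:R).
  apply: HM => v; rewrite mxE boot.finset.in_set0 addn0.
  by rewrite divr_ge0 //= ler_pdivrMr // mul1r ler_nat ltnW.
(* The assumption [k <= #|A| + #|B|] provides a coordinate for every open set. *)
have [v v_sq v_i] : exists2 v, v \in sq & index v sq = i.
  have i_lt : (i < size sq)%N by rewrite sq_size (leq_trans (ltn_ord i)).
  case sqE : sq i_lt => [//|v0 sq'] i_lt; exists (nth v0 sq i).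
    by rewrite -sqE mem_nth // sqE.
  by rewrite -sqE index_uniq // sqE.
exists v => // C a aC y.
have hE (C' : {set 'I_n}) : h v (x + \sum_(b in C') grid_step M b) = sgn v * W i v (cell_vertex x C').
  rewrite /h v_i valK /=; congr (_ * _); apply: eq_bigr => m _.
  by rewrite /trace torus2_cell.
have -> : y + grid_step M a = x + \sum_(b in a |: C) grid_step M b.
  by rewrite /y -addrA boot.finset.big_setU1 //=; congr (_ + _); exact: addrC.
rewrite !hE -mulrBr.
have ballC C' := cell_vertex_ball x C'.
have S1t y' t v' : S1 (trace (s i) y' v' t) by exact: coordK_S1.
have W_diff := @angle_sum_exchange R M.+1 (fun m => trace (s i) (cell_vertex x C) v (m%:R / M.+1%:R))
  (fun m => trace (s i) (cell_vertex x (a |: C)) v (m%:R / M.+1%:R)) (fun m => S1t _ _ _) (fun m => S1t _ _ _).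
rewrite /W W_diff => [|m m_lt]; last first.
  have m01 : 0 <= (m%:R / M.+1%:R : R) <= 1.
    by rewrite divr_ge0 //= ler_pdivrMr // mul1r ler_nat ltnW.
  have d2 : 0 < 2 / M.+1%:R :> R by rewrite divr_gt0.
  have step : `|m%:R / M.+1%:R - m.+1%:R / M.+1%:R| < 2 / M.+1%:R :> R.
    rewrite -mulrBl normrM [`|_^-1|]gtr0_norm ?invr_gt0 // ltr_pM2r ?invr_gt0 //.
    by rewrite -natr1 opprD addrA subrr sub0r normrN normr1 ltr1n.
  have [_ H1] := Hi _ _ (ballC C) (ballC C).
  have [_ H2] := Hi _ _ (ballC C) (ballC (a |: C)).
  by split; [exact: H1|apply: H2 => //; rewrite subrr normr0|exact: H2].
have UC C' : U i (torus2 (cell_vertex x C')) by have [] := Hi _ _ (ballC C') (ballC C').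
rewrite /trace mulr0n mul0r divff ?(gt_eqF N_gt0) // !sec0 // !sec1 // /torus2 /= !coordK_torus_pt // /torus_coord.
rewrite /sgn; case: ifP v_sq => [vA _|vA].
  rewrite (negPf (disAB vA)) angle_incr_id sub0r mul1r cell_vertex_step //.
  by rewrite subrr.
rewrite mem_cat !mem_enum vA /= => vB.
by rewrite vB angle_incr_id subr0 mulN1r cell_vertex_step // subrr.
Qed.

End TorusLowerBound.

(** * Topological complexity of random graph complexes *)

(** Some finite cover exists, hence a least one, and the default of [xget] does not occur. *)
Lemma TC_minP (R : realType) (X : topologicalType) (k : nat) : @tc_cover R X k ->
  @tc_cover R X (TC R X) /\ (TC R X <= k)%N.
Proof.
move=> Xk; have ex_cover : exists j, `[< @tc_cover R X j >] by exists k; exact/asboolP.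
have [m /asboolP Xm m_min] := ex_minnP ex_cover.
have minP j : @tc_cover R X j -> (m <= j)%N by move=> Xj; apply: m_min; exact/asboolP.
rewrite /TC; case: xgetP => [j _ [Xj j_min]|/(_ m)]; last by case.
by split => //; exact: j_min.
Qed.

Lemma exists_subset_card (T : finType) (S : {set T}) (k : nat) : (k <= #|S|)%N ->
  exists2 S' : {set T}, S' \subset S & #|S'| = k.
Proof.
move=> kS; exists (boot.finset.finset (mem (take k (enum S)))).
  by apply/fintype.subsetP => v; rewrite boot.finset.inE => /mem_take; rewrite mem_enum.
rewrite boot.finset.cardsE (card_uniqP (take_uniq _ (enum_uniq _))) size_take -cardE.
by case: ltngtP kS.
Qed.

(** Excluding cliques of size [c.+1] excludes larger ones, as subsets of cliques are cliques. The
    strict lower bound supplies the term [+ 1]. *)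
Lemma TC_clique_complex_bounds (R : realType) (n : nat) (E : {set 'I_n * 'I_n}) (r c : nat) :
  disjoint_cliques E r -> ~ (exists2 S : {set 'I_n}, #|S| = c.+1 & clique E S) ->
  (2 * r + 1 <= TC R (K_Gamma R E) <= 2 * c + 1)%N.
Proof.
move=> [A [B [Ar Br disAB cliqueA cliqueB]]] no_clique.
have cE (S : {set 'I_n}) : clique E S -> (#|S| <= c)%N.
  move=> cS; rewrite leqNgt; apply/negP => /exists_subset_card[S' S'S S'c].
  by apply: no_clique; exists S' => //; exact: clique_subset cS.
have [TC_cover TC_le] := TC_minP (tc_cover_clique_complex R cE).
have dis v : v \in A -> v \notin B by move=> vA; rewrite (disjointFr disAB).
have := tc_cover_lower_bound cliqueA cliqueB dis TC_cover.
by rewrite Ar Br addnn -mul2n TC_le addn1 andbT.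
Qed.

Local Open Scope classical_set_scope.

Theorem theorem5 (R : realType) (p eps : R)
    (hp0 : 0 < p) (hp1 : p < 1) (heps0 : 0 < eps) (heps1 : eps < 2^-1) :
  (fun n : nat =>
     @prob_graph R p n (fun E : {set 'I_n * 'I_n} =>
       ~ ((2 * Num.floor (@zfun R n p - eps) + 1 <= (TC R (K_Gamma R E))%:Z) /\
          ((TC R (K_Gamma R E))%:Z <= 2 * Num.floor (@zfun R n p + eps) + 1))))
  @ \oo --> (0 : R).
Proof.
(* With [q = p^-1], [lam] is [ln q] and [L n] below is [log_q n]. *)
pose lam := - ln p; have lam_gt0 : 0 < lam.
  by rewrite oppr_gt0 -ln1 ltr_ln ?posrE.
have pE : p = expR (- lam) by rewrite opprK lnK ?posrE.
have lnq : ln p^-1 = lam by rewrite lnV ?posrE.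
pose L (n : nat) : R := ln n%:R / lam.
have L_cvg : L n @[n --> \oo] --> +oo.
  apply/cvgryPge => a; near=> n; rewrite /L ler_pdivlMr //.
  have n_gt0 : 0 < n%:R :> R by rewrite ltr0n; near: n; exact: nbhs_infty_gt.
  by rewrite -ler_expR lnK ?posrE //; near: n; exact: nbhs_infty_ger.
have zE n : zfun n p = clique_scale lam (L n).
  rewrite /zfun /clique_scale /logb lnq -/(L n) lnM ?posrE ?expR_gt0 ?invr_gt0 //.
  by rewrite expRK lnV ?posrE.
have eps_lt1 : eps < 1 by apply: (lt_trans heps1); rewrite invf_lt1 // ltr1n.
have est := L_cvg _ (clique_prob_estimate lam_gt0 heps0 eps_lt1 pE).
apply: (@squeeze_cvgr _ _ _ _ (fun=> 0) (fun n => failure_bound lam eps (L n))).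
(* Starting at [m.+1] makes [n] positive, so that it is the exponential of [lam * L n]. *)
- case: est => m _ est; exists m.+1 => // n /= mn.
  have n_pos : (0 < n)%N by apply: leq_ltn_trans mn.
  have n_gt0 : 0 < n%:R :> R by rewrite ltr0n.
  rewrite prob_graph_ge0 //=.
  have nE : n%:R = expR (lam * L n).
    by rewrite /L mulrC divfK ?gt_eqF // lnK ?posrE.
  have [r [c [rE cE bound]]] := est n (ltnW mn) n nE.
  (* A graph violating the inequalities has a clique of size [c.+1] or lacks two disjoint cliques of
     size [r]. *)
  apply: le_trans bound; apply: prob_graph_union => // E _.
  rewrite zE rE cE => bad; apply: contrapT => /not_orP[no_clique /contrapT dis].
  apply: bad; have /andP[lo hi] := TC_clique_complex_bounds R dis no_clique.
  by split; lia.
- exact: cvg_cst.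
- exact: cvg_comp L_cvg (cvg_failure_bound lam_gt0 heps0).
Unshelve. all: by end_near. Qed.
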